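(* Let $G(\tau)=\eta^6(\tau)\Big/\Big(\theta\begin{bmatrix}3/5\\3/5\end{bmatrix}(0,\tau)\,\theta\begin{bmatrix}3/5\\7/5\end{bmatrix}(0,\tau)\Big)$. For every $M=\begin{pmatrix} a&b\\ c&d\end{pmatrix}\in\Gamma_{\theta,5}$, $G(M\tau)=\nu_G(M)(c\tau+d)^2G(\tau)$ with $\nu_G(M)=\exp\!\left(\frac{\pi i}{5}g(M)\right)$, where $g(M)=\frac{6b}{5}+\frac{2ab}{5}+\frac{2cd}{5}$ if $M\equiv I\pmod5$; $g(M)=\frac{24b}{5}+\frac{2ab}{5}+\frac{2cd}{5}$ if $M\equiv -I\pmod5$; $g(M)=5+\frac{6d}{5}+\frac{2ab}{5}+\frac{2cd}{5}$ if $M\equiv\begin{pmatrix}0&-1\\1&0\end{pmatrix}\pmod5$; $g(M)=5-\frac{6d}{5}+\frac{2ab}{5}+\frac{2cd}{5}$ if $M\equiv\begin{pmatrix}0&1\\-1&0\end{pmatrix}\pmod5$.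
   Context: $\mathscr{H}$ is the upper half plane, $M\tau=\frac{a\tau+b}{c\tau+d}$, $I$ the identity matrix. $\theta\begin{bmatrix}\epsilon\\ \epsilon'\end{bmatrix}(v,\tau)=\sum_{n\in\mathbb{Z}}\exp\!\Big(2\pi i\Big[\tfrac12\big(n+\tfrac{\epsilon}{2}\big)^2\tau+\big(n+\tfrac{\epsilon}{2}\big)\big(v+\tfrac{\epsilon'}{2}\big)\Big]\Big)$. $\eta(\tau)=q^{1/24}\prod_{n\ge1}(1-q^n)$, $q=e^{2\pi i\tau}$. $\Gamma_{\theta,5}=\{M\in SL(2,\mathbb{Z}): M\equiv\pm\begin{pmatrix}1&0\\0&1\end{pmatrix}\text{ or }\pm\begin{pmatrix}0&-1\\1&0\end{pmatrix}\pmod 5\}$. *)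

(* Defs.v *)
From Coquelicot Require Import Coquelicot.
From Stdlib Require Import Reals ZArith Bool.
Open Scope C_scope.

Definition cexp (z : Complex.C) : Complex.C :=
  (exp (Re z) * cos (Im z), exp (Re z) * sin (Im z))%R.

Definition CSeries (a : nat -> Complex.C) : Complex.C :=
  (Series (fun k => Re (a k)), Series (fun k => Im (a k))).

Definition zsum (f : Z -> Complex.C) : Complex.C :=
  CSeries (fun k => f (Z.of_nat k)) + CSeries (fun k => f (- Z.of_nat (S k))%Z).

Definition CLim (u : nat -> Complex.C) : Complex.C :=
  (real (Lim_seq (fun n => Re (u n))), real (Lim_seq (fun n => Im (u n)))).

Definition theta (eps eps' : R) (v tau : Complex.C) : Complex.C :=
  zsum (fun n =>
    let m : Complex.C := RtoC (IZR n + eps / 2)%R in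
    cexp (RtoC (2 * PI) * Ci *
          (RtoC (/ 2) * m * m * tau + m * (v + RtoC (eps' / 2))))).

Fixpoint cprod1 (N : nat) (f : nat -> Complex.C) : Complex.C :=
  match N with
  | O => RtoC 1
  | S N' => cprod1 N' f * f N
  end.

Definition qq (tau : Complex.C) : Complex.C := cexp (RtoC (2 * PI) * Ci * tau).

Definition eta (tau : Complex.C) : Complex.C :=
  cexp (RtoC (2 * PI) * Ci * tau / RtoC 24) *
  CLim (fun N => cprod1 N (fun n => RtoC 1 - (qq tau) ^ n)).

Definition Gfun (tau : Complex.C) : Complex.C :=
  (eta tau) ^ 6 /
  (theta (3/5) (3/5) (RtoC 0) tau * theta (3/5) (7/5) (RtoC 0) tau).

Definition mobius (a b c d : Z) (tau : Complex.C) : Complex.C :=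
  (RtoC (IZR a) * tau + RtoC (IZR b)) / (RtoC (IZR c) * tau + RtoC (IZR d)).

Definition congr5 (a b c d a' b' c' d' : Z) : Prop :=
  (a mod 5 = a' mod 5 /\ b mod 5 = b' mod 5 /\
   c mod 5 = c' mod 5 /\ d mod 5 = d' mod 5)%Z.

Definition in_Gamma_theta5 (a b c d : Z) : Prop :=
  (a * d - b * c = 1)%Z /\
  (congr5 a b c d 1 0 0 1 \/ congr5 a b c d (-1) 0 0 (-1) \/
   congr5 a b c d 0 (-1) 1 0 \/ congr5 a b c d 0 1 (-1) 0).

Definition congr5b (a b c d a' b' c' d' : Z) : bool :=
  (andb (andb (andb (Z.eqb (a mod 5) (a' mod 5)) (Z.eqb (b mod 5) (b' mod 5))) (Z.eqb (c mod 5) (c' mod 5))) (Z.eqb (d mod 5) (d' mod 5)))%Z.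


(* g(M), by cases of M mod 5 (the four cases are mutually exclusive). *)
Definition gM (a b c d : Z) : R :=
  let common := (2 * IZR a * IZR b / 5 + 2 * IZR c * IZR d / 5)%R in
  if congr5b a b c d 1 0 0 1 then (6 * IZR b / 5 + common)%R
  else if congr5b a b c d (-1) 0 0 (-1) then (24 * IZR b / 5 + common)%R
  else if congr5b a b c d 0 (-1) 1 0 then (5 + 6 * IZR d / 5 + common)%R
  else (5 - 6 * IZR d / 5 + common)%R.

Definition nuG (a b c d : Z) : Complex.C :=
  cexp (RtoC (PI / 5) * Ci * RtoC (gM a b c d)).

(* Main.v *)
Require Import Defs.
From Coquelicot Require Import Coquelicot.
From Stdlib Require Import Reals ZArith Lra Lia Psatz.
(* Imported again so that [C] is the type of complex numbers, not the binomial of Reals. *)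
From Coquelicot Require Import Coquelicot.
Open Scope C_scope.

(** The function [G] is, up to a constant, the reciprocal of the product of two Klein forms
    of characteristics [(-1/5, -1/5)] and [(-1/5, 1/5)].  Normalised by the phase
    [exp (-pi i (u v + u))], the quotient [theta / eta ^ 3] is a modular form of weight [-1]
    on which SL(2,Z) acts exactly through right multiplication on the row [(u, v)]; it is
    multiplied by an explicit root of unity when integers are added to [u] and [v], and it is
    odd in [(u, v)].  Elements of the group permute the two characteristics modulo integers
    and signs, so the multiplier of [G] is read off the translation phases.

    The exact action only has to be checked on generators.  For the inversion, Poisson
    summation (with the Fejer kernel, so that only finite sums are exchanged with integrals)
    gives [theta (tau) = kappa * theta (-1/tau)] with [kappa] the Gaussian integral of
    parameter [tau]; only [kappa ^ 2 = i / tau] is needed because [G] has even weight, and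
    no branch of the square root enters.  Euler's pentagonal number theorem, in the finite
    form due to Shanks, writes [eta] as a theta series in [3 tau], so [eta] is covered too. *)

(** * Exponentials, limits and series in C *)


(** The half-characteristics are 3/10 = 1/2 - 1/5 and 7/10 = 1/2 + 1/5, hence the rows (-1/5, -1/5)
    and (-1/5, 1/5). Modulo integers, the matrix with rows (0, -1), (1, 0) sends the first row to
    the second and the second to minus the first. So matrices congruent to ± that one leave a single
    sign, which is the summand 5 of g(M) since exp(5 pi i / 5) = -1, while those congruent to ± the
    identity leave no sign or two. The products of the integer translations are the source of the
    quadratic part 2ab/5 + 2cd/5. Two obstacles shape the argument. First, the Gaussian constant
    kappa is known only through its square, and so is the inversion of [eta]; therefore two Klein
    forms are handled as one object, in which theta values occur in pairs and [eta] to the sixth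
    power. Second, theta values stand in a denominator; since the inverse of 0 is 0, inversion is
    multiplicative on all of C, and theta identities pass to reciprocals directly. *)

Lemma C_ext (x y : C) : fst x = fst y -> snd x = snd y -> x = y.
Proof. destruct x, y; simpl; intros; subst; reflexivity. Qed.

Lemma cexp_add (x y : C) : cexp (x + y) = cexp x * cexp y.
Proof.
  apply C_ext; unfold cexp, Re, Im; simpl; rewrite exp_plus.
  - rewrite cos_plus; ring.
  - rewrite sin_plus; ring.
Qed.

Lemma cexp_0 : cexp 0 = 1.
Proof. apply C_ext; unfold cexp, Re, Im; simpl; rewrite exp_0, ?cos_0, ?sin_0; ring. Qed.

Lemma Cmod_cexp (z : C) : Cmod (cexp z) = exp (Re z).
Proof.
  unfold Cmod, cexp; simpl.
  replace (_ + _)%R with (Rsqr (exp (Re z))).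
  - apply sqrt_Rsqr, Rlt_le, exp_pos.
  - pose proof (sin2_cos2 (Im z)) as H. unfold Rsqr in *.
    transitivity (exp (Re z) * exp (Re z) * (sin (Im z) * sin (Im z) + cos (Im z) * cos (Im z)))%R;
      [rewrite H; ring | ring].
Qed.

Lemma cexp_neq0 (z : C) : cexp z <> 0.
Proof. apply Cmod_gt_0; rewrite Cmod_cexp; apply exp_pos. Qed.

Lemma cexp_opp (z : C) : cexp (- z) = / cexp z.
Proof.
  assert (H : cexp z * cexp (- z) = 1)
    by (rewrite <- cexp_add, <- cexp_0; f_equal; ring).
  rewrite <- (Cmult_1_l (/ cexp z)), <- H. field. apply cexp_neq0.
Qed.

Lemma cexp_pow (z : C) (n : nat) : (cexp z) ^ n = cexp (INR n * z).
Proof.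
  induction n as [|n IH].
  - simpl. rewrite Cmult_0_l, cexp_0; reflexivity.
  - rewrite S_INR, RtoC_plus.
    replace ((INR n + 1) * z) with (z + INR n * z) by ring.
    rewrite cexp_add, <- IH; reflexivity.
Qed.

Notation ipi := (RtoC PI * Ci).

Lemma cexp_2ipi : cexp (2 * ipi) = 1.
Proof.
  apply C_ext; unfold cexp, Re, Im; simpl;
    replace (2 * (PI * 0 - 0 * 1) - 0 * (PI * 1 + 0 * 0))%R with 0%R by ring;
    replace (2 * (PI * 1 + 0 * 0) + 0 * (PI * 0 - 0 * 1))%R with (2 * PI)%R by ring;
    rewrite exp_0, ?cos_2PI, ?sin_2PI; ring.
Qed.

Lemma cexp_ipi : cexp ipi = - (1).
Proof.
  apply C_ext; unfold cexp, Re, Im; simpl;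
    replace (PI * 0 - 0 * 1)%R with 0%R by ring;
    replace (PI * 1 + 0 * 0)%R with PI by ring;
    rewrite exp_0, ?cos_PI, ?sin_PI; ring.
Qed.

Lemma cexp_2ipi_Z (n : Z) : cexp (2 * ipi * IZR n) = 1.
Proof.
  assert (H : forall k : nat, cexp (2 * ipi * INR k) = 1).
  { intros k. replace (2 * ipi * INR k) with (INR k * (2 * ipi)) by ring.
    rewrite <- cexp_pow, cexp_2ipi, Cpow_1_l; reflexivity. }
  destruct (Z_le_dec 0 n) as [Hn|Hn].
  - rewrite <- (Z2Nat.id n Hn), <- INR_IZR_INZ; apply H.
  - replace n with (- (- n))%Z by ring. rewrite opp_IZR, RtoC_opp.
    replace (2 * ipi * - IZR (- n)) with (- (2 * ipi * IZR (- n))) by ring.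
    rewrite cexp_opp, <- (Z2Nat.id (- n)) by lia. rewrite <- INR_IZR_INZ, H.
    field.
Qed.

Lemma cexp_eq_mod (n : Z) (x y : C) : x = y + 2 * ipi * IZR n -> cexp x = cexp y.
Proof. intros ->. rewrite cexp_add, cexp_2ipi_Z. ring. Qed.

Lemma Re_ipi (z : C) : Re (ipi * z) = (- (PI * Im z))%R.
Proof. destruct z; unfold Re, Im; simpl; ring. Qed.

Lemma im_le_Cmod (z : C) : (Rabs (Im z) <= Cmod z)%R.
Proof. pose proof (Rmax_Cmod z). unfold Im. eapply Rle_trans; [apply Rmax_r | exact H]. Qed.

Lemma Cmod_le_ReIm (z : C) : (Cmod z <= Rabs (Re z) + Rabs (Im z))%R.
Proof.
  replace z with (RtoC (Re z) + Ci * RtoC (Im z)) at 1.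
  - eapply Rle_trans; [apply Cmod_triangle|].
    rewrite Cmod_mult, Cmod_Ci, !Cmod_R. lra.
  - apply C_ext; unfold Re, Im; simpl; ring.
Qed.

(** With the convention that the inverse of 0 is 0, this holds for all x and y, so transformation
    formulas for theta values can be inverted factor by factor. *)
Lemma Cinv_mult_distr (x y : C) : / (x * y) = / x * / y.
Proof.
  assert (H0 : / (RtoC 0) = 0).
  { apply C_ext; simpl; unfold Rdiv; ring. }
  destruct (Ceq_dec x 0) as [->|Hx]; [rewrite Cmult_0_l, H0; ring|].
  destruct (Ceq_dec y 0) as [->|Hy]; [rewrite Cmult_0_r, H0; ring|].
  field; split; assumption.
Qed.

(** Convergence is a predicate because [CLim] and [CSeries] are total and return default values on
    divergent input. [CLim_Clim] and [CSeries_Clim] connect them with this predicate once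
    convergence, respectively domination, is known. *)
Definition Clim (u : nat -> C) (l : C) : Prop :=
  is_lim_seq (fun n => Cmod (u n - l)) 0%R.

Lemma Clim_squeeze (u : nat -> C) (l : C) (e : nat -> R) :
  (forall n, (Cmod (u n - l) <= e n)%R) -> is_lim_seq e 0%R -> Clim u l.
Proof.
  intros H He. apply is_lim_seq_le_le with (fun _ => 0%R) e; trivial.
  - intros n; split; [apply Cmod_ge_0 | apply H].
  - apply is_lim_seq_const.
Qed.

Lemma Clim_ext (u v : nat -> C) (l : C) : (forall n, u n = v n) -> Clim u l -> Clim v l.
Proof. intros H. apply is_lim_seq_ext; intros n; rewrite H; reflexivity. Qed.

Lemma Clim_const (l : C) : Clim (fun _ => l) l.
Proof.
  apply is_lim_seq_ext with (fun _ => 0%R); [|apply is_lim_seq_const].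
  intros _. replace (l - l) with (RtoC 0) by ring. rewrite Cmod_0; reflexivity.
Qed.

Lemma is_lim_seq_plus0 (u v : nat -> R) :
  is_lim_seq u 0%R -> is_lim_seq v 0%R -> is_lim_seq (fun n => u n + v n)%R 0%R.
Proof. intros. replace 0%R with (0 + 0)%R by ring. apply is_lim_seq_plus'; assumption. Qed.

Lemma is_lim_seq_scal0 (c : R) (u : nat -> R) :
  is_lim_seq u 0%R -> is_lim_seq (fun n => c * u n)%R 0%R.
Proof.
  intros H. replace (Finite 0) with (Rbar_mult c 0%R) by (simpl; f_equal; ring).
  apply is_lim_seq_scal_l, H.
Qed.

Lemma Clim_plus (u v : nat -> C) (l m : C) :
  Clim u l -> Clim v m -> Clim (fun n => u n + v n) (l + m).
Proof.
  intros Hu Hv. apply Clim_squeeze with (fun n => Cmod (u n - l) + Cmod (v n - m))%R.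
  - intros n. replace (u n + v n - (l + m)) with (u n - l + (v n - m)) by ring.
    apply Cmod_triangle.
  - apply is_lim_seq_plus0; assumption.
Qed.

Lemma Clim_scal (c : C) (u : nat -> C) (l : C) :
  Clim u l -> Clim (fun n => c * u n) (c * l).
Proof.
  intros Hu. apply Clim_squeeze with (fun n => Cmod c * Cmod (u n - l))%R.
  - intros n. replace (c * u n - c * l) with (c * (u n - l)) by ring.
    rewrite Cmod_mult; lra.
  - apply is_lim_seq_scal0; assumption.
Qed.

Lemma Clim_minus (u v : nat -> C) (l m : C) :
  Clim u l -> Clim v m -> Clim (fun n => u n - v n) (l - m).
Proof.
  intros Hu Hv. replace (l - m) with (l + - (1) * m) by ring.
  apply Clim_ext with (fun n => u n + - (1) * v n); [intros; ring|].
  apply Clim_plus; trivial. apply Clim_scal; trivial.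
Qed.

Lemma Clim_mult (u v : nat -> C) (l m : C) :
  Clim u l -> Clim v m -> Clim (fun n => u n * v n) (l * m).
Proof.
  intros Hu Hv.
  apply Clim_squeeze with (fun n => Cmod (u n - l) * Cmod (v n - m) +
     (Cmod m * Cmod (u n - l) + Cmod l * Cmod (v n - m)))%R.
  - intros n.
    replace (u n * v n - l * m) with
      ((u n - l) * (v n - m) + (m * (u n - l) + l * (v n - m))) by ring.
    eapply Rle_trans; [apply Cmod_triangle|]. rewrite Cmod_mult.
    apply Rplus_le_compat_l.
    eapply Rle_trans; [apply Cmod_triangle|]. rewrite !Cmod_mult; lra.
  - apply is_lim_seq_plus0; [|apply is_lim_seq_plus0; apply is_lim_seq_scal0; assumption].
    replace 0%R with (0 * 0)%R by ring. apply is_lim_seq_mult'; assumption.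
Qed.

Lemma Clim_subseq (u : nat -> C) (l : C) (phi : nat -> nat) :
  (forall n, (n <= phi n)%nat) -> Clim u l -> Clim (fun n => u (phi n)) l.
Proof.
  intros Hphi Hu. refine (is_lim_seq_subseq _ _ phi _ Hu).
  intros P [N HN]. exists N. intros n Hn. apply HN. specialize (Hphi n); lia.
Qed.

Lemma Clim_unique (u : nat -> C) (l m : C) : Clim u l -> Clim u m -> l = m.
Proof.
  intros Hl Hm. apply Ceq_minus, Cmod_eq_0.
  pose proof (Clim_minus _ _ _ _ Hl Hm) as H. unfold Clim in H.
  apply is_lim_seq_ext with (v := fun _ => Cmod (l - m)) in H.
  - apply is_lim_seq_unique in H. rewrite Lim_seq_const in H. congruence.
  - intros n. rewrite <- (Cmod_opp (l - m)). f_equal; ring.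
Qed.

Lemma Clim_le_0 (u : nat -> C) (l : C) (K : R) :
  Clim u l -> (forall n, (Cmod (u n) <= K)%R) -> (Cmod l <= K)%R.
Proof.
  intros Hu HK.
  assert (H : is_lim_seq (fun n => K + Cmod (u n - l))%R K).
  { replace (Finite K) with (Finite (K + 0)%R) by (f_equal; ring).
    apply is_lim_seq_plus'; [apply is_lim_seq_const | exact Hu]. }
  refine (is_lim_seq_le (fun _ => Cmod l) _ (Cmod l) K _ (is_lim_seq_const _) H).
  intros n. replace l with (u n + - (u n - l)) at 1 by ring.
  eapply Rle_trans; [apply Cmod_triangle|]. rewrite Cmod_opp.
  specialize (HK n); lra.
Qed.

Lemma Clim_Re (u : nat -> C) (l : C) : Clim u l -> is_lim_seq (fun n => Re (u n)) (Re l).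
Proof.
  intros H. apply is_lim_seq_ext with (fun n => Re (u n - l) + Re l)%R.
  { intros n. unfold Re; simpl; ring. }
  replace (Finite (Re l)) with (Finite (0 + Re l)%R) by (f_equal; ring).
  apply is_lim_seq_plus'; [|apply is_lim_seq_const].
  apply is_lim_seq_abs_0.
  apply is_lim_seq_le_le with (fun _ => 0%R) (fun n => Cmod (u n - l)); trivial.
  - intros n; split; [apply Rabs_pos | apply re_le_Cmod].
  - apply is_lim_seq_const.
Qed.

Lemma Clim_Im (u : nat -> C) (l : C) : Clim u l -> is_lim_seq (fun n => Im (u n)) (Im l).
Proof.
  intros H. apply is_lim_seq_ext with (fun n => Im (u n - l) + Im l)%R.
  { intros n. unfold Im; simpl; ring. }
  replace (Finite (Im l)) with (Finite (0 + Im l)%R) by (f_equal; ring).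
  apply is_lim_seq_plus'; [|apply is_lim_seq_const].
  apply is_lim_seq_abs_0.
  apply is_lim_seq_le_le with (fun _ => 0%R) (fun n => Cmod (u n - l)); trivial.
  - intros n; split; [apply Rabs_pos | apply im_le_Cmod].
  - apply is_lim_seq_const.
Qed.

Lemma Clim_intro (u : nat -> C) (l : C) :
  is_lim_seq (fun n => Re (u n)) (Re l) -> is_lim_seq (fun n => Im (u n)) (Im l) ->
  Clim u l.
Proof.
  intros Hr Hi.
  apply Clim_squeeze with (fun n => Rabs (Re (u n) - Re l) + Rabs (Im (u n) - Im l))%R.
  - intros n. apply Cmod_le_ReIm.
  - assert (A : forall (v : nat -> R) (x : R), is_lim_seq v x ->
       is_lim_seq (fun n => Rabs (v n - x)) 0%R).
    { intros v x Hv. apply -> is_lim_seq_abs_0.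
      replace (Finite 0) with (Finite (x - x)%R) by (f_equal; ring).
      apply is_lim_seq_minus'; [exact Hv | apply is_lim_seq_const]. }
    apply is_lim_seq_plus0; apply A; assumption.
Qed.

Lemma CLim_Clim (u : nat -> C) (l : C) : Clim u l -> CLim u = l.
Proof.
  intros H. apply C_ext; unfold CLim; simpl.
  - rewrite (is_lim_seq_unique _ _ (Clim_Re _ _ H)); reflexivity.
  - rewrite (is_lim_seq_unique _ _ (Clim_Im _ _ H)); reflexivity.
Qed.

(** * Finite sums and dominated one-sided series *)

Fixpoint csum (f : nat -> C) (n : nat) : C :=
  match n with O => 0 | S n' => csum f n' + f n' end.

Lemma csum_ext (f g : nat -> C) (n : nat) :
  (forall k, (k < n)%nat -> f k = g k) -> csum f n = csum g n.
Proof. induction n; simpl; intros H; [reflexivity|]. rewrite IHn, H; auto. Qed.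

Lemma csum_scal (c : C) (f : nat -> C) (n : nat) :
  csum (fun k => c * f k) n = c * csum f n.
Proof. induction n; simpl; [|rewrite IHn]; ring. Qed.

Lemma csum_plus (f g : nat -> C) (n : nat) :
  csum (fun k => f k + g k) n = csum f n + csum g n.
Proof. induction n; simpl; [|rewrite IHn]; ring. Qed.

Lemma csum_const (c : C) (n : nat) : csum (fun _ => c) n = RtoC (INR n) * c.
Proof. induction n; [simpl; ring|]. rewrite S_INR, RtoC_plus; simpl csum. rewrite IHn; ring. Qed.

Lemma csum_S_l (f : nat -> C) (n : nat) :
  csum f (S n) = f O + csum (fun k => f (S k)) n.
Proof. induction n; [simpl; ring|]. simpl csum in *. rewrite IHn; ring. Qed.

Lemma csum_Clim (f : nat -> nat -> C) (l : nat -> C) (n : nat) :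
  (forall k, (k < n)%nat -> Clim (fun N => f N k) (l k)) ->
  Clim (fun N => csum (f N) n) (csum l n).
Proof.
  induction n; simpl; intros H; [apply Clim_const|].
  apply Clim_plus; auto.
Qed.

Lemma sum_n_Re (f : nat -> C) (n : nat) :
  sum_n (fun k => Re (f k)) n = Re (csum f (S n)).
Proof.
  induction n; [rewrite sum_O; unfold Re; simpl; ring|].
  rewrite sum_Sn, IHn. unfold Re; simpl. unfold plus; simpl; ring.
Qed.

Lemma sum_n_Im (f : nat -> C) (n : nat) :
  sum_n (fun k => Im (f k)) n = Im (csum f (S n)).
Proof.
  induction n; [rewrite sum_O; unfold Im; simpl; ring|].
  rewrite sum_Sn, IHn. unfold Im; simpl. unfold plus; simpl; ring.
Qed.

Lemma CSeries_Clim (f : nat -> C) (b : nat -> R) :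
  (forall n, (Cmod (f n) <= b n)%R) -> ex_series b -> Clim (csum f) (CSeries f).
Proof.
  intros H Hb.
  assert (Hr : ex_series (fun k => Re (f k))).
  { apply (ex_series_le (V := R_CompleteNormedModule) _ b); trivial. intros n.
    eapply Rle_trans; [apply re_le_Cmod | apply H]. }
  assert (Hi : ex_series (fun k => Im (f k))).
  { apply (ex_series_le (V := R_CompleteNormedModule) _ b); trivial. intros n.
    eapply Rle_trans; [apply im_le_Cmod | apply H]. }
  apply Series_correct in Hr, Hi.
  apply Clim_intro; apply is_lim_seq_incr_1.
  - apply is_lim_seq_ext with (2 := Hr). intros n. apply sum_n_Re.
  - apply is_lim_seq_ext with (2 := Hi). intros n. apply sum_n_Im.
Qed.

Lemma csum_bound (f : nat -> C) (b : nat -> R) (n : nat) :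
  (forall k, (k < n)%nat -> (Cmod (f k) <= b k)%R) ->
  (Cmod (csum f n) <= Re (csum (fun k => RtoC (b k)) n))%R.
Proof.
  induction n; simpl; intros H; [rewrite Cmod_0; lra|].
  eapply Rle_trans; [apply Cmod_triangle|].
  change (Cmod (csum f n) + Cmod (f n) <= Re (csum (fun k => RtoC (b k)) n) + b n)%R.
  apply Rplus_le_compat; auto.
Qed.

Lemma csum_bound_const (f : nat -> C) (K : R) (n : nat) :
  (forall k, (k < n)%nat -> (Cmod (f k) <= K)%R) -> (Cmod (csum f n) <= INR n * K)%R.
Proof.
  intros H. eapply Rle_trans; [apply csum_bound with (b := fun _ => K); exact H|].
  rewrite csum_const. unfold Re; simpl. lra.
Qed.

Lemma ex_series_exp (K c : R) : (0 < c)%R -> ex_series (fun n => K * exp (- (c * INR n)))%R.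
Proof.
  intros Hc. apply (ex_series_scal_l K (fun n => exp (- (c * INR n)))).
  apply ex_series_ext with (fun n => (exp (- c)) ^ n)%R.
  - intros n. induction n; simpl pow.
    + simpl. rewrite Rmult_0_r, Ropp_0, exp_0; reflexivity.
    + rewrite IHn, S_INR, <- exp_plus. f_equal; ring.
  - apply ex_series_geom. rewrite Rabs_pos_eq by (apply Rlt_le, exp_pos).
    rewrite <- exp_0. apply exp_increasing; lra.
Qed.

(** * Series over Z through symmetric partial sums *)

Fixpoint psum (f : Z -> C) (n : nat) : C :=
  match n with
  | O => f 0%Z
  | S n' => psum f n' + (f (Z.of_nat n) + f (- Z.of_nat n)%Z)
  end.

(** One fixed rate serves every series below: Gaussian terms decay faster than any exponential, and
    an affine change of index with nonzero integer slope only enlarges the constant K. *)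
Definition zdom (f : Z -> C) : Prop :=
  exists K, forall n, (Cmod (f n) <= K * exp (- Rabs (IZR n)))%R.

Lemma psum_ext (f g : Z -> C) (n : nat) : (forall k, f k = g k) -> psum f n = psum g n.
Proof. intros H; induction n; simpl; rewrite ?IHn, !H; reflexivity. Qed.

Lemma psum_scal (c : C) (f : Z -> C) (n : nat) : psum (fun k => c * f k) n = c * psum f n.
Proof. induction n; simpl; rewrite ?IHn; ring. Qed.

Lemma psum_plus (f g : Z -> C) (n : nat) :
  psum (fun k => f k + g k) n = psum f n + psum g n.
Proof. induction n; simpl; rewrite ?IHn; ring. Qed.

Lemma zdom_const_nonneg (f : Z -> C) (K : R) :
  (forall n, (Cmod (f n) <= K * exp (- Rabs (IZR n)))%R) -> (0 <= K)%R.
Proof.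
  intros H. specialize (H 0%Z). rewrite Rabs_R0, Ropp_0, exp_0 in H.
  pose proof (Cmod_ge_0 (f 0%Z)); lra.
Qed.

Lemma Rabs_ofnat (n : nat) : Rabs (IZR (Z.of_nat n)) = INR n.
Proof. rewrite <- INR_IZR_INZ. apply Rabs_pos_eq, pos_INR. Qed.

Lemma zsum_psum (f : Z -> C) : zdom f -> Clim (psum f) (zsum f).
Proof.
  intros [K HK].
  assert (H1 : Clim (csum (fun k => f (Z.of_nat k))) (CSeries (fun k => f (Z.of_nat k)))).
  { apply CSeries_Clim with (fun n => K * exp (- (1 * INR n)))%R; [|apply ex_series_exp; lra].
    intros n. eapply Rle_trans; [apply HK|]. rewrite Rabs_ofnat, Rmult_1_l. lra. }
  assert (H2 : Clim (csum (fun k => f (- Z.of_nat (S k))%Z))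
                    (CSeries (fun k => f (- Z.of_nat (S k))%Z))).
  { apply CSeries_Clim with (fun n => K * exp (- (1 * INR n)))%R; [|apply ex_series_exp; lra].
    intros n. eapply Rle_trans; [apply HK|]. rewrite opp_IZR, Rabs_Ropp, Rabs_ofnat, S_INR.
    apply Rmult_le_compat_l; [apply (zdom_const_nonneg f), HK|].
    apply Rlt_le, exp_increasing; lra. }
  apply Clim_subseq with (phi := S) in H1; [|lia].
  pose proof (Clim_plus _ _ _ _ H1 H2) as H. unfold zsum.
  apply Clim_ext with (2 := H). clear. intros n.
  induction n; [simpl; ring|].
  cbn [psum]. rewrite <- IHn. cbn [csum]. ring.
Qed.

Lemma zsum_ext (f g : Z -> C) : (forall k, f k = g k) -> zsum f = zsum g.
Proof.
  intros H. unfold zsum, CSeries.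
  f_equal; f_equal; apply Series_ext; intros; rewrite H; reflexivity.
Qed.

Lemma zdom_scal (c : C) (f : Z -> C) : zdom f -> zdom (fun n => c * f n).
Proof.
  intros [K HK]. exists (Cmod c * K)%R. intros n. rewrite Cmod_mult, Rmult_assoc.
  apply Rmult_le_compat_l; [apply Cmod_ge_0 | apply HK].
Qed.

Lemma zsum_scal (c : C) (f : Z -> C) : zdom f -> zsum (fun n => c * f n) = c * zsum f.
Proof.
  intros H. apply Clim_unique with (psum (fun n => c * f n)).
  - apply zsum_psum, zdom_scal, H.
  - apply Clim_ext with (fun n => c * psum f n).
    + intros; rewrite psum_scal; reflexivity.
    + apply Clim_scal, zsum_psum, H.
Qed.

Lemma zdom_affine (f : Z -> C) (e m : Z) :
  (e <> 0)%Z -> zdom f -> zdom (fun n => f (e * n + m)%Z).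
Proof.
  intros He [K HK]. exists (K * exp (Rabs (IZR m)))%R. intros n.
  eapply Rle_trans; [apply HK|]. rewrite Rmult_assoc, <- exp_plus.
  apply Rmult_le_compat_l; [apply (zdom_const_nonneg f), HK|].
  (* As |e| >= 1, |e n + m| >= |n| - |m|. *)
  assert (- Rabs (IZR (e * n + m)) <= Rabs (IZR m) + - Rabs (IZR n))%R.
  { rewrite <- !abs_IZR, <- !opp_IZR, <- plus_IZR. apply IZR_le. nia. }
  destruct H as [H|H]; [apply Rlt_le, exp_increasing, H | rewrite H; lra].
Qed.

Lemma Clim_zdom (f : Z -> C) (m : Z) (e : Z) : (e <> 0)%Z ->
  zdom f -> Clim (fun n => f (e * Z.of_nat n + m)%Z) 0.
Proof.
  intros He Hf. destruct (zdom_affine f e m He Hf) as [K HK].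
  apply Clim_squeeze with (fun n => K * exp (- (1 * INR n)))%R.
  - intros n. replace (_ - 0) with (f (e * Z.of_nat n + m)%Z) by ring.
    eapply Rle_trans; [apply HK|]. rewrite Rabs_ofnat, Rmult_1_l; lra.
  - apply ex_series_lim_0, ex_series_exp; lra.
Qed.

Lemma zsum_shift1 (f : Z -> C) : zdom f -> zsum (fun n => f (n + 1)%Z) = zsum f.
Proof.
  intros Hf.
  assert (Hg : zdom (fun n => f (n + 1)%Z)).
  { destruct (zdom_affine f 1 1 ltac:(lia) Hf) as [K HK]. exists K.
    intros n. specialize (HK n). rewrite Z.mul_1_l in HK. exact HK. }
  apply Clim_unique with (psum (fun n => f (n + 1)%Z)); [apply zsum_psum, Hg|].
  (* The window from -n to n moved up by one gains f(n+1) and loses f(-n); both boundary terms tend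
     to 0. *)
  apply Clim_ext with (fun n => psum f n +
     (f (1 * Z.of_nat n + 1)%Z - f (-1 * Z.of_nat n + 0)%Z)).
  - intros n. induction n.
    + simpl. ring.
    + cbn [psum]. rewrite <- IHn.
      replace (1 * Z.of_nat (S n) + 1)%Z with (Z.of_nat (S n) + 1)%Z by ring.
      replace (1 * Z.of_nat n + 1)%Z with (Z.of_nat (S n))%Z by lia.
      replace (-1 * Z.of_nat n + 0)%Z with (- Z.of_nat (S n) + 1)%Z by lia.
      replace (-1 * Z.of_nat (S n) + 0)%Z with (- Z.of_nat (S n))%Z by lia.
      ring.
  - replace (zsum f) with (zsum f + (0 - 0)) by ring.
    apply Clim_plus; [apply zsum_psum, Hf|].
    apply Clim_minus; apply Clim_zdom; trivial; lia.
Qed.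

Lemma zsum_shift (f : Z -> C) (m : Z) : zdom f -> zsum (fun n => f (n + m)%Z) = zsum f.
Proof.
  intros Hf.
  assert (Hg : forall k, zdom (fun n => f (n + k)%Z)).
  { intros k. destruct (zdom_affine f 1 k ltac:(lia) Hf) as [K HK]. exists K.
    intros n. specialize (HK n). rewrite Z.mul_1_l in HK. exact HK. }
  assert (P : forall k : nat, zsum (fun n => f (n + Z.of_nat k)%Z) = zsum f).
  { induction k.
    - apply zsum_ext. intros n. f_equal; simpl; ring.
    - rewrite <- IHk, <- (zsum_shift1 (fun n => f (n + Z.of_nat k)%Z)) by apply Hg.
      apply zsum_ext; intros n; f_equal; lia. }
  assert (Q : forall k : nat, zsum (fun n => f (n - Z.of_nat k)%Z) = zsum f).
  { induction k.
    - apply zsum_ext. intros n. f_equal; simpl; ring.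
    - rewrite <- IHk, <- (zsum_shift1 (fun n => f (n - Z.of_nat (S k))%Z)).
      + apply zsum_ext; intros n; f_equal; lia.
      + apply (Hg (- Z.of_nat (S k))%Z). }
  destruct (Z_le_dec 0 m).
  - rewrite <- (P (Z.to_nat m)). apply zsum_ext; intros; f_equal; lia.
  - rewrite <- (Q (Z.to_nat (- m))). apply zsum_ext; intros; f_equal; lia.
Qed.

Lemma zsum_opp (f : Z -> C) : zdom f -> zsum (fun n => f (- n)%Z) = zsum f.
Proof.
  intros Hf.
  assert (Hg : zdom (fun n => f (- n)%Z)).
  { destruct (zdom_affine f (-1) 0 ltac:(lia) Hf) as [K HK]. exists K.
    intros n. specialize (HK n). rewrite Z.add_0_r in HK.
    replace (-1 * n)%Z with (- n)%Z in HK by ring. exact HK. }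
  apply Clim_unique with (psum (fun n => f (- n)%Z)); [apply zsum_psum, Hg|].
  apply Clim_ext with (psum f); [|apply zsum_psum, Hf].
  intros n. induction n; [reflexivity|]. cbn [psum].
  rewrite IHn, Z.opp_involutive. ring.
Qed.

Lemma zsum_mod3 (f : Z -> C) : zdom f ->
  zsum f = zsum (fun n => f (3 * n)%Z) + zsum (fun n => f (3 * n + 1)%Z)
           + zsum (fun n => f (3 * n + -1)%Z).
Proof.
  intros Hf.
  assert (H0 : zdom (fun n => f (3 * n)%Z)).
  { destruct (zdom_affine f 3 0 ltac:(lia) Hf) as [K HK]. exists K.
    intros n. specialize (HK n). rewrite Z.add_0_r in HK. exact HK. }
  (* The window |m| <= 3n + 1 is exactly the union of the numbers 3k, 3k + 1, 3k - 1 with |k| <= n,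
     so the splitting is exact at each finite stage. The residue -1 in place of 2 keeps the window
     symmetric. *)
  apply Clim_unique with (fun n => psum f (3 * n + 1)).
  - apply Clim_subseq with (phi := fun n => (3 * n + 1)%nat); [lia|]. apply zsum_psum, Hf.
  - apply Clim_ext with (fun n => psum (fun n => f (3 * n)%Z) n
       + psum (fun n => f (3 * n + 1)%Z) n + psum (fun n => f (3 * n + -1)%Z) n).
    + intros n. induction n.
      * simpl. ring.
      * replace (3 * S n + 1)%nat with (S (S (S (3 * n + 1)))) by lia.
        cbn [psum]. rewrite <- IHn.
        replace (3 * Z.of_nat (S n))%Z with (Z.of_nat (S (S (3 * n + 1))))%Z by lia.
        replace (3 * - Z.of_nat (S n))%Z with (- Z.of_nat (S (S (3 * n + 1))))%Z by lia.
        replace (Z.of_nat (S (S (3 * n + 1))) + 1)%Z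
          with (Z.of_nat (S (S (S (3 * n + 1)))))%Z by lia.
        replace (Z.of_nat (S (S (3 * n + 1))) + -1)%Z
          with (Z.of_nat (S (3 * n + 1)))%Z by lia.
        replace (- Z.of_nat (S (S (3 * n + 1))) + 1)%Z
          with (- Z.of_nat (S (3 * n + 1)))%Z by lia.
        replace (- Z.of_nat (S (S (3 * n + 1))) + -1)%Z
          with (- Z.of_nat (S (S (S (3 * n + 1)))))%Z by lia.
        ring.
    + apply Clim_plus; [apply Clim_plus|]; apply zsum_psum; trivial;
        apply (zdom_affine f 3); trivial; lia.
Qed.

(** * Integrals of complex functions of a real variable *)


(** Continuity, derivative and integral of complex functions are taken componentwise, so that each
    rule reduces to the real theorems on [continuous], [is_derive] and [RInt]. *)
Definition Ccont (f : R -> C) : Prop :=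
  forall x, continuous (fun t => Re (f t)) x /\ continuous (fun t => Im (f t)) x.

Definition Cder (f f' : R -> C) : Prop :=
  forall x, is_derive (fun t => Re (f t)) x (Re (f' x)) /\
            is_derive (fun t => Im (f t)) x (Im (f' x)).

Definition CInt (f : R -> C) (a b : R) : C :=
  (RInt (fun t => Re (f t)) a b, RInt (fun t => Im (f t)) a b).

Lemma Cder_cont (f f' : R -> C) : Cder f f' -> Ccont f.
Proof.
  intros H x; destruct (H x) as [H1 H2]; split;
    apply (ex_derive_continuous (V := R_NormedModule)); eexists; eassumption.
Qed.

Lemma Cder_ext (f g f' g' : R -> C) :
  (forall x, f x = g x) -> (forall x, f' x = g' x) -> Cder f f' -> Cder g g'.
Proof.
  intros Hf Hg H x. destruct (H x) as [H1 H2]. rewrite <- Hg. split.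
  - apply is_derive_ext with (2 := H1). intros t; rewrite Hf; reflexivity.
  - apply is_derive_ext with (2 := H2). intros t; rewrite Hf; reflexivity.
Qed.

Lemma Ccont_ext (f g : R -> C) : (forall x, f x = g x) -> Ccont f -> Ccont g.
Proof.
  intros Hf H x. destruct (H x) as [H1 H2]. split.
  - apply continuous_ext with (2 := H1). intros t; rewrite Hf; reflexivity.
  - apply continuous_ext with (2 := H2). intros t; rewrite Hf; reflexivity.
Qed.

Lemma Cder_const (c : C) : Cder (fun _ => c) (fun _ => 0).
Proof. intros x; split; apply (is_derive_const (V := R_NormedModule)). Qed.

Lemma Cder_RtoC (f f' : R -> R) :
  (forall x, is_derive f x (f' x)) -> Cder (fun x => RtoC (f x)) (fun x => RtoC (f' x)).
Proof.
  intros H x; split; [exact (H x) | exact (is_derive_const (V := R_NormedModule) 0%R x)].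
Qed.

Lemma Cder_id : Cder (fun x => RtoC x) (fun _ => 1).
Proof. apply (Cder_RtoC (fun x => x) (fun _ => 1%R)). intros x. exact (is_derive_id (K := R_AbsRing) x). Qed.

Lemma Cder_plus (f g f' g' : R -> C) :
  Cder f f' -> Cder g g' -> Cder (fun x => f x + g x) (fun x => f' x + g' x).
Proof.
  intros Hf Hg x. destruct (Hf x), (Hg x).
  split; apply (is_derive_plus (V := R_NormedModule)); assumption.
Qed.

Lemma is_derive_Rmult (f g : R -> R) (x df dg : R) :
  is_derive f x df -> is_derive g x dg ->
  is_derive (fun t => f t * g t)%R x (df * g x + f x * dg)%R.
Proof. intros Hf Hg. apply (is_derive_mult f g x df dg Hf Hg). apply Rmult_comm. Qed.

Lemma Cder_mult (f g f' g' : R -> C) :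
  Cder f f' -> Cder g g' ->
  Cder (fun x => f x * g x) (fun x => f' x * g x + f x * g' x).
Proof.
  intros Hf Hg x. destruct (Hf x) as [A B], (Hg x) as [A' B']. split.
  - pose proof (is_derive_minus (V := R_NormedModule) _ _ _ _ _
      (is_derive_Rmult _ _ _ _ _ A A') (is_derive_Rmult _ _ _ _ _ B B')) as H.
    eapply eq_rect; [exact H|]. unfold minus, plus, opp, Re, Im; simpl; ring.
  - pose proof (is_derive_plus (V := R_NormedModule) _ _ _ _ _
      (is_derive_Rmult _ _ _ _ _ A B') (is_derive_Rmult _ _ _ _ _ B A')) as H.
    eapply eq_rect.
    + eapply is_derive_ext; [|exact H]. intros t. unfold plus, Re, Im; simpl; ring.
    + unfold plus, Re, Im; simpl; ring.
Qed.

Lemma Cder_scal (c : C) (f f' : R -> C) :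
  Cder f f' -> Cder (fun x => c * f x) (fun x => c * f' x).
Proof.
  intros H. eapply Cder_ext; [| |apply (Cder_mult _ _ _ _ (Cder_const c) H)];
    intros; simpl; ring.
Qed.

Lemma Cder_comp (f f' : R -> C) (h h' : R -> R) :
  Cder f f' -> (forall x, is_derive h x (h' x)) ->
  Cder (fun x => f (h x)) (fun x => RtoC (h' x) * f' (h x)).
Proof.
  intros Hf Hh x. destruct (Hf (h x)) as [A B]. split.
  - eapply eq_rect;
      [apply (is_derive_comp (V := R_NormedModule) (fun t => Re (f t)) h _ _ _ A (Hh x))|].
    unfold scal, Re; simpl. unfold mult; simpl. ring.
  - eapply eq_rect;
      [apply (is_derive_comp (V := R_NormedModule) (fun t => Im (f t)) h _ _ _ B (Hh x))|].
    unfold scal, Im; simpl. unfold mult; simpl. ring.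
Qed.

Lemma Cder_comp_lin (f f' : R -> C) (u v : R) :
  Cder f f' -> Cder (fun x => f (u * x + v)%R) (fun x => RtoC u * f' (u * x + v)%R).
Proof.
  intros Hf. apply (Cder_comp f f' (fun x => u * x + v)%R (fun _ => u) Hf).
  intros x. auto_derive; trivial; ring.
Qed.

Lemma is_derive_Rexp (f : R -> R) (x df : R) :
  is_derive f x df -> is_derive (fun t => exp (f t)) x (df * exp (f x))%R.
Proof. intros H. apply (is_derive_comp exp f x _ _ (is_derive_exp (f x)) H). Qed.

Lemma is_derive_Rcos (f : R -> R) (x df : R) :
  is_derive f x df -> is_derive (fun t => cos (f t)) x (df * - sin (f x))%R.
Proof. intros H. apply (is_derive_comp cos f x _ _ (is_derive_cos (f x)) H). Qed.

Lemma is_derive_Rsin (f : R -> R) (x df : R) :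
  is_derive f x df -> is_derive (fun t => sin (f t)) x (df * cos (f x))%R.
Proof. intros H. apply (is_derive_comp sin f x _ _ (is_derive_sin (f x)) H). Qed.

Lemma Cder_cexp (f f' : R -> C) :
  Cder f f' -> Cder (fun x => cexp (f x)) (fun x => f' x * cexp (f x)).
Proof.
  intros Hf x. destruct (Hf x) as [A B]. split.
  - eapply eq_rect;
      [exact (is_derive_Rmult _ _ _ _ _ (is_derive_Rexp _ _ _ A) (is_derive_Rcos _ _ _ B))|].
    unfold cexp, Re, Im; simpl; ring.
  - eapply eq_rect;
      [exact (is_derive_Rmult _ _ _ _ _ (is_derive_Rexp _ _ _ A) (is_derive_Rsin _ _ _ B))|].
    unfold cexp, Re, Im; simpl; ring.
Qed.

Lemma Ccont_const (c : C) : Ccont (fun _ => c).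
Proof. eapply Cder_cont, Cder_const. Qed.

Lemma Ccont_plus (f g : R -> C) : Ccont f -> Ccont g -> Ccont (fun x => f x + g x).
Proof.
  intros Hf Hg x. destruct (Hf x), (Hg x).
  split; apply (continuous_plus (V := R_NormedModule)); assumption.
Qed.

Lemma Ccont_mult (f g : R -> C) : Ccont f -> Ccont g -> Ccont (fun x => f x * g x).
Proof.
  intros Hf Hg x. destruct (Hf x), (Hg x). split.
  - apply (continuous_minus (V := R_NormedModule)); apply (continuous_mult (K := R_AbsRing));
      assumption.
  - apply (continuous_plus (V := R_NormedModule)); apply (continuous_mult (K := R_AbsRing));
      assumption.
Qed.

Lemma Ccont_scal (c : C) (f : R -> C) : Ccont f -> Ccont (fun x => c * f x).
Proof. intros; apply Ccont_mult; [apply Ccont_const | assumption]. Qed.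

Lemma Ccont_minus (f g : R -> C) : Ccont f -> Ccont g -> Ccont (fun x => f x - g x).
Proof.
  intros Hf Hg. apply Ccont_ext with (fun x => f x + - (1) * g x); [intros; ring|].
  apply Ccont_plus, Ccont_scal; assumption.
Qed.

Lemma Ccont_comp_lin (f : R -> C) (u v : R) : Ccont f -> Ccont (fun x => f (u * x + v)%R).
Proof.
  intros Hf x. destruct (Hf (u * x + v)%R).
  assert (continuous (fun x => (u * x + v)%R) x)
    by (apply (ex_derive_continuous (V := R_NormedModule)); auto_derive; trivial).
  split.
  - apply (continuous_comp (fun x => (u * x + v)%R) (fun t => Re (f t))); assumption.
  - apply (continuous_comp (fun x => (u * x + v)%R) (fun t => Im (f t))); assumption.
Qed.

Lemma Ccont_csum (f : nat -> R -> C) (n : nat) :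
  (forall k, Ccont (f k)) -> Ccont (fun x => csum (fun k => f k x) n).
Proof. intros H; induction n; simpl; [apply Ccont_const|]. apply Ccont_plus; auto. Qed.

Lemma Ccont_ex_RInt (f : R -> C) (a b : R) : Ccont f ->
  ex_RInt (fun t => Re (f t)) a b /\ ex_RInt (fun t => Im (f t)) a b.
Proof.
  intros H; split; apply (ex_RInt_continuous (V := R_CompleteNormedModule));
    intros; apply H.
Qed.

Lemma CInt_ext (f g : R -> C) (a b : R) :
  (forall x, f x = g x) -> CInt f a b = CInt g a b.
Proof. intros H; unfold CInt; f_equal; apply RInt_ext; intros; rewrite H; reflexivity. Qed.

Lemma CInt_plus (f g : R -> C) (a b : R) : Ccont f -> Ccont g ->
  CInt (fun x => f x + g x) a b = CInt f a b + CInt g a b.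
Proof.
  intros Hf Hg.
  destruct (Ccont_ex_RInt f a b Hf), (Ccont_ex_RInt g a b Hg).
  apply C_ext; unfold CInt; simpl; apply (RInt_plus (V := R_CompleteNormedModule));
    assumption.
Qed.

Lemma RInt_Rscal (c : R) (f : R -> R) (a b : R) : ex_RInt f a b ->
  RInt (fun x => c * f x)%R a b = (c * RInt f a b)%R.
Proof. apply (RInt_scal (V := R_CompleteNormedModule)). Qed.

Lemma CInt_scal (c : C) (f : R -> C) (a b : R) : Ccont f ->
  CInt (fun x => c * f x) a b = c * CInt f a b.
Proof.
  intros Hf. destruct (Ccont_ex_RInt f a b Hf) as [H1 H2].
  assert (S : forall (k : R) g, ex_RInt g a b -> ex_RInt (fun x => k * g x)%R a b)
    by (intros; apply (ex_RInt_scal (V := R_NormedModule)); assumption).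
  apply C_ext; unfold CInt; simpl.
  - rewrite <- !RInt_Rscal by assumption.
    apply (RInt_minus (V := R_CompleteNormedModule) (fun x => fst c * Re (f x))%R
             (fun x => snd c * Im (f x))%R); apply S; assumption.
  - rewrite <- !RInt_Rscal by assumption.
    apply (RInt_plus (V := R_CompleteNormedModule) (fun x => fst c * Im (f x))%R
             (fun x => snd c * Re (f x))%R); apply S; assumption.
Qed.

Lemma CInt_minus (f g : R -> C) (a b : R) : Ccont f -> Ccont g ->
  CInt (fun x => f x - g x) a b = CInt f a b - CInt g a b.
Proof.
  intros Hf Hg.
  rewrite (CInt_ext _ (fun x => f x + - (1) * g x)) by (intros; ring).
  rewrite CInt_plus, CInt_scal by (trivial; apply Ccont_scal; trivial). ring.
Qed.

Lemma CInt_const (c : C) (a b : R) : CInt (fun _ => c) a b = RtoC (b - a) * c.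
Proof.
  apply C_ext; unfold CInt; simpl; rewrite (RInt_const (V := R_CompleteNormedModule));
    unfold scal, Re, Im; simpl; unfold mult; simpl; ring.
Qed.

Lemma CInt_csum (f : nat -> R -> C) (n : nat) (a b : R) : (forall k, Ccont (f k)) ->
  CInt (fun x => csum (fun k => f k x) n) a b = csum (fun k => CInt (f k) a b) n.
Proof.
  intros H; induction n; simpl.
  - rewrite CInt_const; ring.
  - rewrite CInt_plus, IHn by (trivial; apply Ccont_csum, H). reflexivity.
Qed.

Lemma CInt_Chasles (f : R -> C) (a b c : R) : Ccont f ->
  CInt f a b + CInt f b c = CInt f a c.
Proof.
  intros Hf. destruct (Ccont_ex_RInt f a b Hf), (Ccont_ex_RInt f b c Hf).
  apply C_ext; unfold CInt; simpl; apply (RInt_Chasles (V := R_CompleteNormedModule));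
    assumption.
Qed.

Lemma CInt_comp_lin (f : R -> C) (u v a b : R) : Ccont f ->
  RtoC u * CInt (fun x => f (u * x + v)%R) a b = CInt f (u * a + v) (u * b + v).
Proof.
  intros Hf. pose proof (Ccont_comp_lin f u v Hf) as Hf'.
  rewrite <- CInt_scal by assumption.
  destruct (Ccont_ex_RInt f (u * a + v) (u * b + v) Hf) as [A B].
  apply C_ext; unfold CInt; simpl.
  - rewrite <- (RInt_comp_lin (V := R_CompleteNormedModule)) by exact A.
    apply RInt_ext; intros. unfold scal, Re; simpl; unfold mult; simpl; ring.
  - rewrite <- (RInt_comp_lin (V := R_CompleteNormedModule)) by exact B.
    apply RInt_ext; intros. unfold scal, Im; simpl; unfold mult; simpl; ring.
Qed.

Lemma CInt_FTC (F f : R -> C) (a b : R) : Cder F f -> Ccont f ->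
  CInt f a b = F b - F a.
Proof.
  intros HF Hf. apply C_ext; unfold CInt; simpl; apply is_RInt_unique.
  - apply (is_RInt_derive (V := R_CompleteNormedModule) (fun t => Re (F t)));
      intros; [apply HF | apply Hf].
  - apply (is_RInt_derive (V := R_CompleteNormedModule) (fun t => Im (F t)));
      intros; [apply HF | apply Hf].
Qed.

(* Rotating the integral onto the positive axis reduces the bound to the real case. *)
Lemma CInt_bound (f : R -> C) (a b K : R) : (a <= b)%R -> Ccont f ->
  (forall x, (a <= x <= b)%R -> (Cmod (f x) <= K)%R) ->
  (Cmod (CInt f a b) <= K * (b - a))%R.
Proof.
  intros Hab Hf HK. set (v := CInt f a b).
  destruct (Req_dec (Cmod v) 0) as [H0|H0].
  { rewrite H0. apply Rmult_le_pos; [|lra].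
    eapply Rle_trans; [apply Cmod_ge_0 | apply (HK a); lra]. }
  pose proof (Cmod_ge_0 v) as Hv.
  apply Rmult_le_reg_l with (Cmod v); [lra|].
  replace (Cmod v * Cmod v)%R with (Re (Cconj v * v)).
  - unfold v at 2. rewrite <- CInt_scal by assumption.
    pose proof (Ccont_scal (Cconj v) f Hf) as Hg.
    destruct (Ccont_ex_RInt _ a b Hg) as [A _].
    replace (Cmod v * (K * (b - a)))%R with (RInt (fun _ => Cmod v * K)%R a b).
    + change (RInt (fun t => Re (Cconj v * f t)) a b <= RInt (fun _ => Cmod v * K)%R a b)%R.
      apply RInt_le; trivial.
      * apply (ex_RInt_const (V := R_NormedModule)).
      * intros x Hx. eapply Rle_trans; [apply Rle_abs|].
        eapply Rle_trans; [apply re_le_Cmod|]. rewrite Cmod_mult, Cmod_conj.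
        apply Rmult_le_compat_l; [lra | apply HK; lra].
    + rewrite (RInt_const (V := R_CompleteNormedModule)).
      unfold scal; simpl; unfold mult; simpl; ring.
  - transitivity (Cmod v ^ 2)%R; [|ring]. rewrite Cmod2_alt. unfold Re, Im; simpl; ring.
Qed.

(** Mean value inequality. A complex function need not have a mean value point, so the increment is
    written as the integral of the derivative. *)
Lemma Cder_bound (f f' : R -> C) (a b K : R) : (a <= b)%R -> Cder f f' -> Ccont f' ->
  (forall x, (a <= x <= b)%R -> (Cmod (f' x) <= K)%R) ->
  (Cmod (f b - f a) <= K * (b - a))%R.
Proof.
  intros Hab Hf Hf' HK. rewrite <- (CInt_FTC f f') by assumption.
  apply CInt_bound; assumption.
Qed.

(** Joint continuity is the condition that differentiation under the integral sign puts on the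
    derivative in the parameter. *)
Definition C2cont (F : R -> R -> C) : Prop :=
  forall x y, continuity_2d_pt (fun u v => Re (F u v)) x y /\
              continuity_2d_pt (fun u v => Im (F u v)) x y.

Lemma C2cont_RtoC (g : R -> R -> R) :
  (forall x y, continuity_2d_pt g x y) -> C2cont (fun x y => RtoC (g x y)).
Proof. intros H x y; split; [apply H | exact (continuity_2d_pt_const x y 0%R)]. Qed.

Lemma C2cont_const (c : C) : C2cont (fun _ _ => c).
Proof. intros x y; split; apply continuity_2d_pt_const. Qed.

Lemma C2cont_plus (F G : R -> R -> C) :
  C2cont F -> C2cont G -> C2cont (fun x y => F x y + G x y).
Proof.
  intros HF HG x y. destruct (HF x y), (HG x y).
  split; apply continuity_2d_pt_plus; assumption.
Qed.

Lemma C2cont_mult (F G : R -> R -> C) :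
  C2cont F -> C2cont G -> C2cont (fun x y => F x y * G x y).
Proof.
  intros HF HG x y. destruct (HF x y), (HG x y). split.
  - apply continuity_2d_pt_minus; apply continuity_2d_pt_mult; assumption.
  - apply continuity_2d_pt_plus; apply continuity_2d_pt_mult; assumption.
Qed.

Lemma C2cont_cexp (F : R -> R -> C) : C2cont F -> C2cont (fun x y => cexp (F x y)).
Proof.
  intros HF x y. destruct (HF x y).
  assert (He : forall x, continuity_pt exp x)
    by (intros; apply derivable_continuous_pt, derivable_pt_exp).
  assert (A := continuity_1d_2d_pt_comp exp _ x y (He _) H).
  assert (B := continuity_1d_2d_pt_comp cos _ x y (continuity_cos _) H0).
  assert (D := continuity_1d_2d_pt_comp sin _ x y (continuity_sin _) H0).
  split.
  - exact (continuity_2d_pt_mult _ _ x y A B).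
  - exact (continuity_2d_pt_mult _ _ x y A D).
Qed.

Lemma RInt_param_derive (F F' : R -> R -> R) (a b : R) :
  (forall s x, is_derive (fun s => F s x) s (F' s x)) ->
  (forall s, ex_RInt (F s) a b) ->
  (forall s x, continuity_2d_pt F' s x) ->
  forall s, is_derive (fun s => RInt (F s) a b) s (RInt (F' s) a b).
Proof.
  intros HD HI HC s.
  assert (E : forall s x, Derive (fun u => F u x) s = F' s x)
    by (intros; apply is_derive_unique, HD).
  rewrite <- (RInt_ext (fun x => Derive (fun u => F u x) s)) by (intros; apply E).
  apply is_derive_RInt_param.
  - apply filter_forall. intros y t _. eexists; apply HD.
  - intros t _. apply continuity_2d_pt_ext with F'; [intros; symmetry; apply E | apply HC].
  - apply filter_forall. intros y. apply HI.
Qed.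

Lemma CInt_param_derive (F F' : R -> R -> C) (a b : R) :
  (forall x, Cder (fun s => F s x) (fun s => F' s x)) ->
  (forall s, Ccont (F s)) -> C2cont F' ->
  Cder (fun s => CInt (F s) a b) (fun s => CInt (F' s) a b).
Proof.
  intros HD HI HC s. split.
  - apply (RInt_param_derive (fun s x => Re (F s x)) (fun s x => Re (F' s x))).
    + intros s' x; apply (HD x s').
    + intros s'; apply (Ccont_ex_RInt (F s') a b (HI s')).
    + intros s' x; apply (HC s' x).
  - apply (RInt_param_derive (fun s x => Im (F s x)) (fun s x => Im (F' s x))).
    + intros s' x; apply (HD x s').
    + intros s'; apply (Ccont_ex_RInt (F s') a b (HI s')).
    + intros s' x; apply (HC s' x).
Qed.

(** * Gaussian integrals with complex parameter *)


Definition gauss (tau z : C) : C := cexp (ipi * (tau * (z * z))).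

Lemma exp_le (x y : R) : (x <= y)%R -> (exp x <= exp y)%R.
Proof. intros [H|E]; [apply Rlt_le, exp_increasing, H | rewrite E; lra]. Qed.

(** The real part of the exponent is - pi Im(tau) x^2 plus terms at most linear in |x|, so any
    linear rate L is beaten after completing the square. Uniformity over s in [0, 1] serves the
    displacement of the line of integration from x to x + w. *)
Lemma gauss_decay (tau w : C) (L : R) : (0 < Im tau)%R ->
  exists K, (0 < K)%R /\ forall s x, (0 <= s <= 1)%R ->
    (Cmod (gauss tau (RtoC x + RtoC s * w)) <= K * exp (- (L * Rabs x)))%R.
Proof.
  intros Ht. pose proof PI_RGT_0 as HPI.
  set (B := (2 * Rabs (Im (tau * w)))%R). set (D := Rabs (Im (tau * (w * w)))).
  set (p := (PI * Im tau)%R). set (b := (PI * B + L)%R).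
  assert (Hp : (0 < p)%R) by (apply Rmult_lt_0_compat; assumption).
  exists (exp (PI * D + b * b / (4 * p))). split; [apply exp_pos|].
  intros s x Hs. unfold gauss. rewrite Cmod_cexp, Re_ipi, <- exp_plus.
  apply exp_le.
  replace (Im (tau * ((RtoC x + RtoC s * w) * (RtoC x + RtoC s * w))))
    with (Im tau * (x * x) + s * (2 * x * Im (tau * w)) + s * s * Im (tau * (w * w)))%R
    by (unfold Im; simpl; ring).
  assert (Hx : (x * x = Rabs x * Rabs x)%R) by (rewrite <- Rabs_mult; symmetry; apply Rabs_pos_eq; nra).
  set (y := Rabs x) in *. assert (Hy : (0 <= y)%R) by apply Rabs_pos.
  assert (H1 : (- (B * y) <= s * (2 * x * Im (tau * w)))%R).
  { assert (Rabs (s * (2 * x * Im (tau * w))) <= B * y)%R.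
    { rewrite !Rabs_mult, (Rabs_pos_eq s), (Rabs_pos_eq 2) by lra. fold y. unfold B.
      pose proof (Rabs_pos (Im (tau * w))). 
      assert (0 <= y * Rabs (Im (tau * w)))%R by (apply Rmult_le_pos; lra). nra. }
    pose proof (Rle_abs (- (s * (2 * x * Im (tau * w))))) as A. rewrite Rabs_Ropp in A. lra. }
  assert (H2 : (- D <= s * s * Im (tau * (w * w)))%R).
  { assert (Rabs (s * s * Im (tau * (w * w))) <= D)%R.
    { rewrite !Rabs_mult, (Rabs_pos_eq s) by lra. fold D.
      assert (0 <= D)%R by apply Rabs_pos.
      assert (s * s <= 1)%R by nra. nra. }
    pose proof (Rle_abs (- (s * s * Im (tau * (w * w))))) as A. rewrite Rabs_Ropp in A. lra. }
  (* b y - p y^2 has maximum b^2 / (4p); this is where the constant in K comes from. *)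
  assert (H3 : (b * y <= p * (y * y) + b * b / (4 * p))%R).
  { assert (0 <= (2 * p * y - b) * (2 * p * y - b) / (4 * p))%R.
    { apply Rmult_le_pos; [apply Rle_0_sqr | apply Rlt_le, Rinv_0_lt_compat; lra]. }
    replace ((2 * p * y - b) * (2 * p * y - b) / (4 * p))%R
      with (p * (y * y) + b * b / (4 * p) - b * y)%R in H by (field; lra). lra. }
  rewrite Hx.
  assert (PI * - (B * y) <= PI * (s * (2 * x * Im (tau * w))))%R
    by (apply Rmult_le_compat_l; lra).
  assert (PI * - D <= PI * (s * s * Im (tau * (w * w))))%R
    by (apply Rmult_le_compat_l; lra).
  unfold b, p in *. nra.
Qed.

Lemma gauss_decay1 (tau w : C) (L : R) : (0 < Im tau)%R ->
  exists K, (0 < K)%R /\ forall x,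
    (Cmod (gauss tau (RtoC x + w)) <= K * exp (- (L * Rabs x)))%R.
Proof.
  intros Ht. destruct (gauss_decay tau w L Ht) as [K [HK H]]. exists K; split; trivial.
  intros x. specialize (H 1%R x ltac:(lra)). rewrite Cmult_1_l in H. exact H.
Qed.

Lemma gauss_Cder_gen (tau : C) (z z' : R -> C) : Cder z z' ->
  Cder (fun x => gauss tau (z x)) (fun x => z' x * (2 * ipi * tau * z x * gauss tau (z x))).
Proof.
  intros Hz. unfold gauss.
  eapply Cder_ext; [| |apply Cder_cexp, (Cder_scal ipi), (Cder_scal tau), (Cder_mult _ _ _ _ Hz Hz)];
    intros; simpl; [reflexivity | ring].
Qed.

Lemma gauss_Cder (tau w : C) :
  Cder (fun x => gauss tau (RtoC x + w))
       (fun x => 2 * ipi * tau * (RtoC x + w) * gauss tau (RtoC x + w)).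
Proof.
  eapply Cder_ext; [| |apply (gauss_Cder_gen tau _ _ (Cder_plus _ _ _ _ Cder_id (Cder_const w)))];
    intros; simpl; [reflexivity | ring].
Qed.

Lemma gauss_Ccont (tau w : C) : Ccont (fun x => gauss tau (RtoC x + w)).
Proof. eapply Cder_cont, gauss_Cder. Qed.

Lemma gauss_Cder2 (tau w : C) :
  Cder (fun x => 2 * ipi * tau * (RtoC x + w) * gauss tau (RtoC x + w))
       (fun x => (2 * ipi * tau + (2 * ipi * tau * (RtoC x + w)) * (2 * ipi * tau * (RtoC x + w)))
                 * gauss tau (RtoC x + w)).
Proof.
  eapply Cder_ext; [| |apply (Cder_mult _ _ _ _
     (Cder_scal (2 * ipi * tau) _ _ (Cder_plus _ _ _ _ Cder_id (Cder_const w)))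
     (gauss_Cder tau w))]; intros; simpl; ring.
Qed.

Lemma gauss_Cder2_cont (tau w : C) :
  Ccont (fun x => (2 * ipi * tau + (2 * ipi * tau * (RtoC x + w)) * (2 * ipi * tau * (RtoC x + w)))
                 * gauss tau (RtoC x + w)).
Proof.
  assert (H : Ccont (fun x => RtoC x + w))
    by (apply Ccont_plus; [eapply Cder_cont, Cder_id | apply Ccont_const]).
  apply Ccont_mult; [|apply gauss_Ccont].
  apply Ccont_plus; [apply Ccont_const|]. apply Ccont_mult; apply Ccont_scal; exact H.
Qed.

(** Square of 1 + y/2 <= exp(y/2), combined with 1 + y <= 2 (1 + y/2). *)
Lemma sqr_le_exp (y : R) : (0 <= y)%R -> ((1 + y) * (1 + y) <= 4 * exp y)%R.
Proof.
  intros Hy. pose proof (exp_ineq1_le (y / 2)) as H.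
  replace (exp y) with (exp (y / 2) * exp (y / 2))%R by (rewrite <- exp_plus; f_equal; field).
  nra.
Qed.

Lemma gauss_Cder2_decay (tau w : C) : (0 < Im tau)%R ->
  exists K, forall x,
    (Cmod ((2 * ipi * tau + (2 * ipi * tau * (RtoC x + w)) * (2 * ipi * tau * (RtoC x + w)))
                 * gauss tau (RtoC x + w)) <= K * exp (- Rabs x))%R.
Proof.
  (* Rate 2: one unit pays for the quadratic factor of the second derivative through [sqr_le_exp],
     and one unit remains in the conclusion. *)
  intros Ht. destruct (gauss_decay1 tau w 2 Ht) as [K [HK H]].
  set (t := 2 * ipi * tau). set (T := Cmod t). set (W := Cmod w).
  assert (HT : (0 <= T)%R) by apply Cmod_ge_0.
  assert (HW : (0 <= W)%R) by apply Cmod_ge_0.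
  exists ((T + T * T * ((1 + W) * (1 + W))) * 4 * K)%R. intros x.
  rewrite Cmod_mult. pose proof (Rabs_pos x) as Hx. set (y := Rabs x) in *.
  assert (A : (Cmod (t + (t * (RtoC x + w)) * (t * (RtoC x + w)))
           <= (T + T * T * ((1 + W) * (1 + W))) * (4 * exp y))%R).
  { eapply Rle_trans; [|apply Rmult_le_compat_l; [|apply sqr_le_exp; exact Hx]].
    2: { assert (0 <= T * T)%R by nra. assert (0 <= (1 + W) * (1 + W))%R by nra. nra. }
    eapply Rle_trans; [apply Cmod_triangle|]. rewrite !Cmod_mult. fold T.
    assert (B : (Cmod (RtoC x + w) <= (1 + W) * (1 + y))%R).
    { eapply Rle_trans; [apply Cmod_triangle|]. rewrite Cmod_R. fold y W. nra. }
    pose proof (Cmod_ge_0 (RtoC x + w)) as B0. set (c := Cmod (RtoC x + w)) in *.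
    assert (c * c <= ((1 + W) * (1 + y)) * ((1 + W) * (1 + y)))%R
      by (apply Rmult_le_compat; lra).
    assert (1 <= (1 + y) * (1 + y))%R by nra.
    assert (T * T * (c * c) <= T * T * (((1 + W) * (1 + y)) * ((1 + W) * (1 + y))))%R
      by (apply Rmult_le_compat_l; nra).
    nra. }
  eapply Rle_trans.
  { apply Rmult_le_compat; [apply Cmod_ge_0 | apply Cmod_ge_0 | exact A | apply H]. }
  fold y. replace (exp (- y)) with (exp y * exp (- (2 * y)))%R
    by (rewrite <- exp_plus; f_equal; ring).
  apply Req_le; ring.
Qed.

Lemma gauss_zdom (tau w : C) : (0 < Im tau)%R -> zdom (fun n => gauss tau (RtoC (IZR n) + w)).
Proof.
  intros Ht. destruct (gauss_decay1 tau w 1 Ht) as [K [_ H]]. exists K.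
  intros n. specialize (H (IZR n)). rewrite Rmult_1_l in H. exact H.
Qed.

Lemma CInt_upper_Cder (f : R -> C) (a : R) : Ccont f -> Cder (fun t => CInt f a t) f.
Proof.
  intros Hf x.
  assert (A : forall y, is_RInt (fun t => Re (f t)) a y (RInt (fun t => Re (f t)) a y)).
  { intros y. exact (RInt_correct (V := R_CompleteNormedModule) _ a y
      (proj1 (Ccont_ex_RInt f a y Hf))). }
  assert (B : forall y, is_RInt (fun t => Im (f t)) a y (RInt (fun t => Im (f t)) a y)).
  { intros y. exact (RInt_correct (V := R_CompleteNormedModule) _ a y
      (proj2 (Ccont_ex_RInt f a y Hf))). }
  split.
  - exact (is_derive_RInt (V := R_NormedModule) (fun t => Re (f t))
      (fun y => RInt (fun t => Re (f t)) a y) a x (filter_forall _ A) (proj1 (Hf x))).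
  - exact (is_derive_RInt (V := R_NormedModule) (fun t => Im (f t))
      (fun y => RInt (fun t => Im (f t)) a y) a x (filter_forall _ B) (proj2 (Hf x))).
Qed.

Section GaussIntegral.
Variable tau : C.
Hypothesis Htau : (0 < Im tau)%R.

Let G (x : R) : C := gauss tau (RtoC x).

Lemma gauss_axis_Cder : Cder G (fun x => 2 * ipi * tau * RtoC x * G x).
Proof.
  eapply Cder_ext; [| |apply (gauss_Cder_gen tau _ _ Cder_id)];
    intros; simpl; [reflexivity | unfold G; ring].
Qed.

Lemma gauss_axis_Ccont : Ccont G.
Proof. eapply Cder_cont, gauss_axis_Cder. Qed.

(** Auxiliary integral of the classical real evaluation. Differentiation in t brings down 2 pi i tau
    t (1 + x^2), which cancels the denominator; the substitution y = t x then leaves G(t) times the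
    integral of G over [0, t]. *)
Let J (t : R) : C :=
  CInt (fun x => cexp (ipi * tau * RtoC (t * t * (1 + x * x))) * RtoC (/ (1 + x * x))) 0 1.

Lemma Ccont_inv_sqr : Ccont (fun x => RtoC (/ (1 + x * x))).
Proof.
  apply (Cder_cont _ (fun x => RtoC (- (2 * x) / ((1 + x * x) * (1 + x * x))))).
  apply Cder_RtoC. intros x. assert (1 + x * x <> 0)%R by nra.
  auto_derive; [exact H | field; exact H].
Qed.

Lemma gauss_aux_Cder : Cder J (fun t => 2 * ipi * tau * G t * CInt G 0 t).
Proof.
  apply Cder_ext with J (fun t => CInt (fun x =>
     2 * ipi * tau * RtoC t * cexp (ipi * tau * RtoC (t * t * (1 + x * x)))) 0 1).
  - reflexivity.
  - intros t.
    replace (CInt G 0 t) with (CInt G (t * 0 + 0) (t * 1 + 0)) by (f_equal; ring).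
    rewrite <- CInt_comp_lin by apply gauss_axis_Ccont.
    rewrite (Cmult_assoc _ (RtoC t)), <- CInt_scal by apply Ccont_comp_lin, gauss_axis_Ccont.
    apply CInt_ext. intros x. unfold G, gauss.
    replace (ipi * tau * RtoC (t * t * (1 + x * x))) with
      (ipi * (tau * (RtoC t * RtoC t))
       + ipi * (tau * (RtoC (t * x + 0) * RtoC (t * x + 0)))).
    + rewrite cexp_add. ring.
    + rewrite !RtoC_plus, !RtoC_mult, !RtoC_plus, !RtoC_mult. ring.
  - apply CInt_param_derive.
    + intros x. assert (1 + x * x <> 0)%R by nra.
      assert (Hd : Cder (fun s => ipi * tau * RtoC (s * s * (1 + x * x)))
                   (fun s => ipi * tau * RtoC (2 * s * (1 + x * x)))).
      { apply Cder_scal, Cder_RtoC. intros s. auto_derive; trivial; ring. }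
      eapply Cder_ext; [| |apply (Cder_mult _ _ _ _ (Cder_cexp _ _ Hd)
         (Cder_const (RtoC (/ (1 + x * x)))))]; intros s; simpl; [reflexivity|].
      rewrite !RtoC_mult, RtoC_inv by exact H. field.
      intros E. apply RtoC_inj in E. exact (H E).
    + intros s. apply Ccont_mult; [|apply Ccont_inv_sqr].
      apply (Cder_cont _ (fun x => ipi * tau * RtoC (2 * s * s * x)
              * cexp (ipi * tau * RtoC (s * s * (1 + x * x))))).
      apply Cder_cexp, Cder_scal, Cder_RtoC. intros x. auto_derive; trivial; ring.
    + apply C2cont_mult; [apply C2cont_mult; [apply C2cont_const | apply C2cont_RtoC]|].
      * apply continuity_2d_pt_id1.
      * apply C2cont_cexp, C2cont_mult; [apply C2cont_const | apply C2cont_RtoC].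
        intros x y. apply continuity_2d_pt_mult.
        -- apply continuity_2d_pt_mult; apply continuity_2d_pt_id1.
        -- apply continuity_2d_pt_plus; [apply continuity_2d_pt_const|].
           apply continuity_2d_pt_mult; apply continuity_2d_pt_id2.
Qed.

Lemma gauss_aux_0 : J 0 = RtoC (PI / 4).
Proof.
  unfold J. rewrite (CInt_ext _ (fun x => RtoC (/ (1 + x * x)))).
  - rewrite (CInt_FTC (fun x => RtoC (atan x))).
    + rewrite atan_1, atan_0. ring.
    + apply Cder_RtoC. intros x.
      exact (is_derive_atan x).
    + apply Ccont_inv_sqr.
  - intros x. rewrite !Rmult_0_l, Cmult_0_r, cexp_0. ring.
Qed.

Lemma gauss_aux_bound (t : R) : (Cmod (J t) <= exp (- (PI * Im tau * (t * t))))%R.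
Proof.
  replace (exp _) with (exp (- (PI * Im tau * (t * t))) * (1 - 0))%R by ring.
  apply CInt_bound; [lra| |].
  - apply Ccont_mult; [|apply Ccont_inv_sqr].
    apply (Cder_cont _ (fun x => ipi * tau * RtoC (2 * t * t * x)
            * cexp (ipi * tau * RtoC (t * t * (1 + x * x))))).
    apply Cder_cexp, Cder_scal, Cder_RtoC. intros x. auto_derive; trivial; ring.
  - intros x _. rewrite Cmod_mult, Cmod_cexp, <- Cmult_assoc, Re_ipi, im_scal_r, Cmod_R.
    assert (0 < / (1 + x * x) <= 1)%R.
    { split; [apply Rinv_0_lt_compat; nra|]. rewrite <- Rinv_1. apply Rinv_le_contravar; nra. }
    rewrite Rabs_pos_eq by lra.
    rewrite <- (Rmult_1_r (exp (- (PI * Im tau * (t * t))))).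
    apply Rmult_le_compat; try lra; [apply Rlt_le, exp_pos|].
    apply exp_le. pose proof PI_RGT_0. assert (0 < PI * Im tau)%R by nra.
    assert (0 <= (t * t) * (x * x))%R by (apply Rmult_le_pos; nra). nra.
Qed.

(* The complex version of the classical evaluation of the Gaussian integral:
   - pi i tau I(t)^2 + J(t) has zero derivative. *)
Lemma gauss_half_square (t : R) : (0 <= t)%R ->
  - ipi * tau * (CInt G 0 t * CInt G 0 t) + J t = RtoC (PI / 4).
Proof.
  intros Ht. pose proof (CInt_upper_Cder G 0 gauss_axis_Ccont) as HI.
  assert (HD : Cder (fun t => - ipi * tau * (CInt G 0 t * CInt G 0 t) + J t) (fun _ => 0)).
  { eapply Cder_ext; [| |apply (Cder_plus _ _ _ _ (Cder_scal (- ipi * tau) _ _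
      (Cder_mult _ _ _ _ HI HI)) gauss_aux_Cder)]; intros s; simpl; [reflexivity | ring]. }
  pose proof (Cder_bound _ _ 0 t 0 Ht HD (Ccont_const 0)) as H.
  rewrite Rmult_0_l in H. cbv beta in H.
  rewrite gauss_aux_0 in H. replace (CInt G 0 0) with (RtoC 0) in H.
  - apply Ceq_minus, Cmod_eq_0, Rle_antisym; [|apply Cmod_ge_0].
    eapply Rle_trans; [|apply H]; [|intros; rewrite Cmod_0; lra].
    apply Req_le; f_equal; ring.
  - symmetry. rewrite (CInt_FTC (fun t => CInt G 0 t) G) by (trivial; apply gauss_axis_Ccont). ring.
Qed.

(** Half-integer end points make the interval a union of unit intervals centred at the integers from
    -N to N, which matches the windows of [psum] in the unfolding of Fourier coefficients. *)
Definition gaussT (N : nat) : C :=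
  CInt G (- (INR N + / 2)) (INR N + / 2).

Lemma gaussT_half (N : nat) : gaussT N = 2 * CInt G 0 (INR N + / 2).
Proof.
  unfold gaussT. rewrite <- (CInt_Chasles G _ 0) by apply gauss_axis_Ccont.
  replace (CInt G (- (INR N + / 2)) 0) with
    (CInt G ((-1) * (INR N + / 2) + 0) ((-1) * 0 + 0)) by (f_equal; ring).
  rewrite <- CInt_comp_lin by apply gauss_axis_Ccont.
  rewrite (CInt_ext _ G).
  - pose proof (CInt_Chasles G 0 (INR N + / 2) 0 gauss_axis_Ccont) as H.
    replace (CInt G 0 0) with (RtoC 0) in H.
    + replace (CInt G (INR N + / 2) 0) with (- CInt G 0 (INR N + / 2)).
      * ring.
      * transitivity (CInt G 0 (INR N + / 2) + CInt G (INR N + / 2) 0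
                      - CInt G 0 (INR N + / 2)); [rewrite H|]; ring.
    + symmetry. rewrite (CInt_FTC (fun t => CInt G 0 t) G);
        [ring | apply CInt_upper_Cder, gauss_axis_Ccont | apply gauss_axis_Ccont].
  - intros x. unfold G, gauss. do 2 f_equal.
    rewrite RtoC_plus, RtoC_mult. ring.
Qed.

Lemma gaussT_lim : exists kappa, Clim gaussT kappa /\ kappa * kappa = Ci / tau.
Proof.
  destruct (gauss_decay1 tau 0 1 Htau) as [K [HK H]].
  assert (HG : forall x, (Cmod (G x) <= K * exp (- Rabs x))%R).
  { intros x. specialize (H x). rewrite Cplus_0_r, Rmult_1_l in H. exact H. }
  (* Convergence of the square would leave a sign undetermined at each N, so the limit itself is
     first obtained, as a series of increments over unit intervals. *)
  assert (HL : exists l, Clim (fun N => CInt G 0 (INR N + / 2)) l).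
  { set (d := fun k => CInt G (INR k + / 2) (INR (S k) + / 2)).
    assert (Hd : Clim (csum d) (CSeries d)).
    { apply CSeries_Clim with (fun n => K * exp (- (1 * INR n)))%R;
        [|apply ex_series_exp; lra].
      intros n. unfold d. pose proof (pos_INR n) as Hn. rewrite S_INR.
      eapply Rle_trans; [apply CInt_bound with (K := (K * exp (- INR n))%R)|].
      - lra.
      - apply gauss_axis_Ccont.
      - intros x Hx. eapply Rle_trans; [apply HG|]. apply Rmult_le_compat_l; [lra|].
        apply exp_le. rewrite Rabs_pos_eq; lra.
      - rewrite Rmult_1_l. apply Req_le; ring. }
    exists (CInt G 0 (/ 2) + CSeries d).
    apply Clim_ext with (fun N => CInt G 0 (/ 2) + csum d N).
    - intros n. induction n.
      + simpl. rewrite Rplus_0_l. ring.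
      + cbn [csum]. rewrite Cplus_assoc, IHn. apply CInt_Chasles, gauss_axis_Ccont.
    - apply Clim_plus; [apply Clim_const | exact Hd]. }
  destruct HL as [l Hl].
  assert (HJ : Clim (fun N => J (INR N + / 2)) 0).
  { apply Clim_squeeze with (fun n => 1 * exp (- (PI * Im tau * INR n)))%R.
    - intros n. replace (_ - 0) with (J (INR n + / 2)) by ring.
      eapply Rle_trans; [apply gauss_aux_bound|]. rewrite Rmult_1_l. apply exp_le.
      pose proof PI_RGT_0. assert (0 < PI * Im tau)%R by nra.
      pose proof (pos_INR n). nra.
    - apply ex_series_lim_0, ex_series_exp. pose proof PI_RGT_0. nra. }
  assert (Ht0 : tau <> 0) by (intros E; rewrite E in Htau; unfold Im in Htau; simpl in Htau; lra).
  assert (E : - ipi * tau * (l * l) + 0 = RtoC (PI / 4)).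
  { apply Clim_unique with (fun N => - ipi * tau *
      (CInt G 0 (INR N + / 2) * CInt G 0 (INR N + / 2)) + J (INR N + / 2)).
    - apply Clim_plus; trivial. apply Clim_scal, Clim_mult; assumption.
    - apply Clim_ext with (fun _ => RtoC (PI / 4)); [|apply Clim_const].
      intros n. symmetry. apply gauss_half_square. pose proof (pos_INR n); lra. }
  exists (2 * l). split.
  - apply Clim_ext with (2 := Clim_scal 2 _ _ Hl). intros; symmetry; apply gaussT_half.
  - assert (HP : RtoC PI <> 0) by (intros A; apply RtoC_inj in A; pose proof PI_RGT_0; lra).
    assert (HCi : Ci * Ci = - (1)) by (apply C_ext; simpl; ring).
    rewrite RtoC_div in E by lra.
    (* For [field], [Ci] is an atom; the relation Ci^2 = -1 is therefore isolated in a separate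
       summand. *)
    transitivity (4 * (- ipi * tau * (l * l) + 0) * (Ci / (tau * RtoC PI))
                  + 4 * (l * l) * (Ci * Ci + 1)).
    + field. split; assumption.
    + rewrite E, HCi. field. split; assumption.
Qed.

(* Shifting the line of integration: the integral over [x + s w] varies in [s] only
   through its two end points. *)
Lemma gaussT_shift (w : C) :
  Clim (fun N => CInt (fun x => gauss tau (RtoC x + w)) (- (INR N + / 2)) (INR N + / 2)
                 - gaussT N) 0.
Proof.
  destruct (gauss_decay tau w 1 Htau) as [K [HK H]].
  apply Clim_squeeze with (fun n => (Cmod w * (2 * K)) * exp (- (1 * INR n)))%R;
    [|apply ex_series_lim_0, ex_series_exp; lra].
  intros n. pose proof (pos_INR n) as Hn. set (T := (INR n + / 2)%R).
  set (h := fun s => CInt (fun x => gauss tau (RtoC x + RtoC s * w)) (- T) T).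
  set (h' := fun s => w * (gauss tau (RtoC T + RtoC s * w) - gauss tau (RtoC (- T) + RtoC s * w))).
  assert (Hs : forall c, Cder (fun s : R => c + RtoC s * w) (fun _ => w)).
  { intros c. eapply Cder_ext; [| |apply (Cder_plus _ _ _ _ (Cder_const c)
      (Cder_mult _ _ _ _ Cder_id (Cder_const w)))]; intros; simpl; [reflexivity | ring]. }
  assert (Hh' : Ccont h').
  { apply Ccont_scal, Ccont_minus; eapply Cder_cont, gauss_Cder_gen, Hs. }
  assert (Hh : Cder h h').
  { apply Cder_ext with h (fun s => CInt (fun x => w * (2 * ipi * tau * (RtoC x + RtoC s * w)
        * gauss tau (RtoC x + RtoC s * w))) (- T) T); [reflexivity| |].
    - intros s. unfold h'. rewrite CInt_scal.
      + f_equal. apply (CInt_FTC (fun x => gauss tau (RtoC x + RtoC s * w))).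
        * apply gauss_Cder.
        * eapply Cder_cont, gauss_Cder2.
      + eapply Cder_cont, gauss_Cder2.
    - apply (CInt_param_derive (fun s x => gauss tau (RtoC x + RtoC s * w))).
      + intros x. apply gauss_Cder_gen, Hs.
      + intros s. apply gauss_Ccont.
      + assert (A : C2cont (fun s x => RtoC x + RtoC s * w)).
        { apply C2cont_plus; [apply C2cont_RtoC; intros; apply continuity_2d_pt_id2|].
          apply C2cont_mult; [apply C2cont_RtoC; intros; apply continuity_2d_pt_id1
            | apply C2cont_const]. }
        apply C2cont_mult; [apply C2cont_const|].
        apply C2cont_mult; [apply C2cont_mult; [apply C2cont_const | exact A]|].
        apply C2cont_cexp, C2cont_mult; [apply C2cont_const|].
        apply C2cont_mult; [apply C2cont_const|]. apply C2cont_mult; exact A. }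
  replace (CInt _ _ _ - gaussT n - 0) with (h 1%R - h 0%R).
  - eapply Rle_trans; [apply (Cder_bound h h' 0 1 (Cmod w * (2 * K) * exp (- INR n)))|];
      trivial; [lra| |].
    + intros s Hs'. unfold h'. rewrite Cmod_mult, Rmult_assoc.
      apply Rmult_le_compat_l; [apply Cmod_ge_0|].
      eapply Rle_trans; [apply Cmod_triangle|]. rewrite Cmod_opp.
      pose proof (H s T Hs') as A. pose proof (H s (- T)%R Hs') as B.
      rewrite Rabs_Ropp in B. rewrite (Rabs_pos_eq T) in A, B by (unfold T; lra).
      assert (exp (- (1 * T)) <= exp (- INR n))%R by (apply exp_le; unfold T; lra).
      nra.
    + rewrite Rmult_1_l. apply Req_le; ring.
  - unfold h, gaussT. fold T.
    assert (E1 : CInt (fun x => gauss tau (RtoC x + RtoC 1 * w)) (- T) T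
                 = CInt (fun x => gauss tau (RtoC x + w)) (- T) T).
    { apply CInt_ext; intros; f_equal; ring. }
    assert (E0 : CInt (fun x => gauss tau (RtoC x + RtoC 0 * w)) (- T) T = CInt G (- T) T).
    { apply CInt_ext; intros; unfold G; f_equal; ring. }
    rewrite E1, E0. ring.
Qed.

End GaussIntegral.

(** * Poisson summation *)


Lemma exp_m1_le : (exp (- (1)) <= / 2)%R.
Proof.
  rewrite exp_Ropp. apply Rinv_le_contravar; [lra|].
  pose proof (exp_ineq1_le 1). lra.
Qed.

Lemma exp_INR_S (n : nat) : (exp (- INR (S n)) <= / 2 * exp (- INR n))%R.
Proof.
  rewrite S_INR. replace (- (INR n + 1))%R with (- (1) + - INR n)%R by ring.
  rewrite exp_plus. apply Rmult_le_compat_r; [apply Rlt_le, exp_pos | apply exp_m1_le].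
Qed.

Lemma psum_step_bound (u : Z -> C) (A : R) (n : nat) :
  (forall n, (Cmod (u n) <= A * exp (- Rabs (IZR n)))%R) ->
  (Cmod (u (Z.of_nat (S n)) + u (- Z.of_nat (S n))%Z) <= A * (exp (- INR n)))%R.
Proof.
  intros H. pose proof (zdom_const_nonneg u A H) as HA.
  eapply Rle_trans; [apply Cmod_triangle|].
  pose proof (H (Z.of_nat (S n))) as H1. pose proof (H (- Z.of_nat (S n))%Z) as H2.
  rewrite opp_IZR, Rabs_Ropp in H2. rewrite Rabs_ofnat in H1, H2.
  pose proof (exp_INR_S n).
  assert (A * exp (- INR (S n)) <= A * (/ 2 * exp (- INR n)))%R
    by (apply Rmult_le_compat_l; lra).
  lra.
Qed.

(** The subtracted term makes the bound inductive: a step at index m costs at most A exp(-m), and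
    this is at most 2 A (exp(-m) - exp(-(m+1))) because exp(-1) <= 1/2. *)
Lemma psum_cauchy (u : Z -> C) (A : R) (n p : nat) :
  (forall n, (Cmod (u n) <= A * exp (- Rabs (IZR n)))%R) ->
  (Cmod (psum u (n + p) - psum u n) <= A * (2 * exp (- INR n) - 2 * exp (- INR (n + p))))%R.
Proof.
  intros H. pose proof (zdom_const_nonneg u A H) as HA. induction p.
  - rewrite Nat.add_0_r. replace (_ - _) with (RtoC 0) by ring. rewrite Cmod_0. lra.
  - rewrite Nat.add_succ_r. cbn [psum].
    replace (_ - _) with (psum u (n + p) - psum u n +
      (u (Z.of_nat (S (n + p))) + u (- Z.of_nat (S (n + p)))%Z)) by ring.
    eapply Rle_trans; [apply Cmod_triangle|].
    pose proof (psum_step_bound u A (n + p) H).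
    pose proof (exp_INR_S (n + p)).
    assert (A * (2 * exp (- INR (S (n + p)))) <= A * exp (- INR (n + p)))%R
      by (apply Rmult_le_compat_l; lra).
    lra.
Qed.

Lemma psum_bound (u : Z -> C) (A : R) (n : nat) :
  (forall n, (Cmod (u n) <= A * exp (- Rabs (IZR n)))%R) ->
  (Cmod (psum u n) <= 3 * A)%R.
Proof.
  intros H. pose proof (psum_cauchy u A 0 n H) as B. rewrite Nat.add_0_l in B.
  replace (psum u n) with (psum u n - psum u 0 + u 0%Z) by (simpl; ring).
  eapply Rle_trans; [apply Cmod_triangle|].
  specialize (H 0%Z) as H0. rewrite Rabs_R0, Ropp_0, exp_0 in H0.
  change (INR 0) with 0%R in B. rewrite Ropp_0, exp_0 in B.
  pose proof (exp_pos (- INR n)) as E. pose proof (zdom_const_nonneg u A H) as HA.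
  pose proof (Rmult_le_pos _ _ HA (Rlt_le _ _ E)). lra.
Qed.

Lemma psum_tail (u : Z -> C) (A : R) (n : nat) :
  (forall n, (Cmod (u n) <= A * exp (- Rabs (IZR n)))%R) ->
  (Cmod (zsum u - psum u n) <= 2 * A * exp (- INR n))%R.
Proof.
  intros H. pose proof (zdom_const_nonneg u A H) as HA.
  assert (Hu : zdom u) by (exists A; exact H).
  apply Clim_le_0 with (fun p => psum u (n + p) - psum u n).
  - apply Clim_minus; [|apply Clim_const].
    apply (Clim_subseq _ _ (fun p => (n + p)%nat)); [lia|]. apply zsum_psum, Hu.
  - intros p. eapply Rle_trans; [apply psum_cauchy, H|].
    pose proof (exp_pos (- INR (n + p))). nra.
Qed.

(** The tails of the symmetric sums are themselves summable, so the sum of the first M of them is M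
    times the limit with an error bounded in M. The term 4 exp(-M) again serves the induction. *)
Lemma csum_psum_bound (u : Z -> C) (A : R) (M : nat) :
  (forall n, (Cmod (u n) <= A * exp (- Rabs (IZR n)))%R) ->
  (Cmod (csum (fun i => psum u i) M - RtoC (INR M) * zsum u)
    <= A * (4 - 4 * exp (- INR M)))%R.
Proof.
  intros H. pose proof (zdom_const_nonneg u A H) as HA. induction M.
  - simpl. rewrite Ropp_0, exp_0. replace (0 - 0 * zsum u) with (RtoC 0) by ring.
    rewrite Cmod_0; lra.
  - rewrite S_INR at 1. rewrite RtoC_plus. cbn [csum].
    replace (_ - _) with (csum (fun i => psum u i) M - RtoC (INR M) * zsum u
      + - (zsum u - psum u M)) by ring.
    eapply Rle_trans; [apply Cmod_triangle|]. rewrite Cmod_opp.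
    pose proof (psum_tail u A M H). pose proof (exp_INR_S M).
    assert (A * (4 * exp (- INR (S M))) <= A * (2 * exp (- INR M)))%R
      by (apply Rmult_le_compat_l; lra).
    lra.
Qed.

(** * Characters, Dirichlet and Fejer kernels *)

Definition echar (m : Z) (x : R) : C := cexp (2 * ipi * (RtoC (IZR m) * RtoC x)).

Lemma echar_add (m n : Z) (x : R) : echar (m + n) x = echar m x * echar n x.
Proof. unfold echar. rewrite <- cexp_add, plus_IZR, RtoC_plus. f_equal; ring. Qed.

Lemma echar_0 (x : R) : echar 0 x = 1.
Proof. unfold echar. rewrite <- cexp_0. f_equal; ring. Qed.

Lemma Cmod_echar (m : Z) (x : R) : Cmod (echar m x) = 1%R.
Proof.
  unfold echar. rewrite Cmod_cexp, <- exp_0. f_equal. unfold Re; simpl; ring.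
Qed.

Lemma echar_shift (m n : Z) (x : R) : echar m (x + IZR n) = echar m x.
Proof.
  unfold echar. apply (cexp_eq_mod (m * n)).
  rewrite mult_IZR, RtoC_plus, RtoC_mult. ring.
Qed.

Lemma echar_Cder (m : Z) :
  Cder (echar m) (fun x => 2 * ipi * RtoC (IZR m) * echar m x).
Proof.
  unfold echar. eapply Cder_ext; [| |apply Cder_cexp, (Cder_scal (2 * ipi)),
    (Cder_scal (RtoC (IZR m))), Cder_id]; intros; simpl; [reflexivity | ring].
Qed.

Lemma echar_Ccont (m : Z) : Ccont (echar m).
Proof. eapply Cder_cont, echar_Cder. Qed.

Definition dirichlet (i : nat) (x : R) : C := psum (fun m => echar m x) i.
(** Unnormalised: M times the usual Fejer kernel, so its integral over a period is M.
    [fejer_telescope] is the closed form sin(pi M x)^2 / sin(pi x)^2 without division. *)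
Definition fejer (M : nat) (x : R) : C := csum (fun i => dirichlet i x) M.

(** The factor, equal to 4 sin(pi x)^2, acts on the characters as minus a second difference.
    Summation over m leaves first differences at both ends, and these telescope once more in the sum
    over i. *)
Lemma dirichlet_telescope (i : nat) (x : R) :
  (2 - echar 1 x - echar (-1) x) * dirichlet i x =
  (echar (Z.of_nat i) x - echar (Z.of_nat (S i)) x)
  + (echar (- Z.of_nat i) x - echar (- Z.of_nat (S i)) x).
Proof.
  unfold dirichlet. induction i.
  - simpl. rewrite echar_0. ring.
  - cbn [psum]. rewrite Cmult_plus_distr_l, IHi.
    assert (E : echar 1 x * echar (-1) x = 1) by (rewrite <- echar_add; apply echar_0).
    rewrite !Nat2Z.inj_succ, !Z.opp_succ. unfold Z.succ, Z.pred. rewrite !echar_add.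
    set (a := echar (Z.of_nat i) x). set (b := echar (- Z.of_nat i) x).
    set (p := echar 1 x) in *. set (q := echar (-1) x) in *.
    transitivity (a - a * p + (b - b * q) + 2 * (a * p + b * q) - p * p * a - b * q * q
       - (p * q) * a - (p * q) * b); [ring | rewrite E; ring].
Qed.

Lemma fejer_telescope (M : nat) (x : R) :
  (2 - echar 1 x - echar (-1) x) * fejer M x =
  2 - echar (Z.of_nat M) x - echar (- Z.of_nat M) x.
Proof.
  unfold fejer. induction M; cbn [csum].
  - simpl. rewrite echar_0. ring.
  - rewrite Cmult_plus_distr_l, IHM, dirichlet_telescope. ring.
Qed.

(** From y - y^3/6 <= sin y and y^2 <= 4. The constant 3 is matched with pi >= 3 to give y <= sin(pi
    y) on [0, 1/2]. *)
Lemma sin_lower (y : R) : (0 <= y <= 2)%R -> (y <= 3 * sin y)%R.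
Proof.
  intros Hy. destruct (pre_sin_bound y 0) as [H _]; [lra | lra |].
  unfold sin_approx, sin_term in H. simpl in H. nra.
Qed.

(** By [fejer_telescope], 4 sin(pi x)^2 times the kernel has modulus at most 4, and sin(pi x)^2 >=
    x^2 on this interval. The bound is uniform in M. *)
Lemma fejer_bound (M : nat) (x : R) : (- / 2 <= x <= / 2)%R ->
  (x * x * Cmod (fejer M x) <= 1)%R.
Proof.
  intros Hx.
  assert (E : 2 - echar 1 x - echar (-1) x = RtoC (4 * (sin (PI * x) * sin (PI * x)))).
  { assert (A : (cos (2 * (PI * x)) = 1 - 2 * sin (PI * x) * sin (PI * x))%R)
      by apply cos_2a_sin.
    apply C_ext; unfold echar, cexp, Re, Im; simpl;
      match goal with |- context [exp ?a] => replace a with 0%R by ring end;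
      match goal with |- context [exp (?a - ?b)] =>
        replace (a - b)%R with 0%R by ring end;
      rewrite exp_0.
    - match goal with |- context [cos ?a] =>
        replace (cos a) with (1 - 2 * sin (PI * x) * sin (PI * x))%R
          by (rewrite <- A; f_equal; ring) end.
      match goal with |- context [cos ?a] =>
        replace (cos a) with (1 - 2 * sin (PI * x) * sin (PI * x))%R
          by (rewrite <- A, <- (cos_neg (2 * (PI * x))); f_equal; ring) end.
      ring.
    - match goal with |- context [sin ?a] =>
        replace (sin a) with (sin (2 * (PI * x))) by (f_equal; ring) end.
      match goal with |- context [(- (1 * sin ?a))%R] =>
        replace (sin a) with (- sin (2 * (PI * x)))%R
          by (rewrite <- sin_neg; f_equal; ring) end.
      ring. }
  pose proof (fejer_telescope M x) as T. rewrite E in T.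
  assert (B : (Cmod (RtoC (4 * (sin (PI * x) * sin (PI * x))) * fejer M x) <= 4)%R).
  { rewrite T. eapply Rle_trans; [apply Cmod_triangle|].
    rewrite Cmod_opp, Cmod_echar.
    assert (Cmod (2 - echar (Z.of_nat M) x) <= 2 + 1)%R; [|lra].
    eapply Rle_trans; [apply Cmod_triangle|].
    rewrite Cmod_opp, Cmod_echar, Cmod_R, Rabs_pos_eq; lra. }
  rewrite Cmod_mult, Cmod_R in B.
  assert (S : (x * x <= sin (PI * x) * sin (PI * x))%R).
  { pose proof PI2_3_2. pose proof PI_4.
    assert (P : forall y, (0 <= y <= / 2)%R -> (y <= sin (PI * y))%R).
    { intros y Hy. assert (0 <= PI * y <= 2)%R by nra.
      pose proof (sin_lower (PI * y) H1). nra. }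
    destruct (Rle_dec 0 x).
    - pose proof (P x ltac:(lra)). nra.
    - pose proof (P (- x)%R ltac:(lra)) as A.
      replace (PI * - x)%R with (- (PI * x))%R in A by ring. rewrite sin_neg in A. nra. }
  rewrite Rabs_pos_eq in B by nra.
  pose proof (Cmod_ge_0 (fejer M x)). nra.
Qed.

Lemma dirichlet_even (i : nat) (x : R) : dirichlet i (- x) = dirichlet i x.
Proof.
  unfold dirichlet.
  assert (E : forall m, echar m (- x) = echar (- m) x).
  { intros m. unfold echar. f_equal. rewrite opp_IZR, !RtoC_opp. ring. }
  induction i; cbn [psum].
  - rewrite E. reflexivity.
  - rewrite IHi, !E, Z.opp_involutive. ring.
Qed.

Lemma fejer_even (M : nat) (x : R) : fejer M (- x) = fejer M x.
Proof. apply csum_ext. intros; apply dirichlet_even. Qed.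

Lemma Ccont_psum (f : Z -> R -> C) (n : nat) :
  (forall k, Ccont (f k)) -> Ccont (fun x => psum (fun k => f k x) n).
Proof.
  intros H; induction n; cbn [psum]; [apply H|].
  apply Ccont_plus; [assumption | apply Ccont_plus; apply H].
Qed.

Lemma CInt_psum (f : Z -> R -> C) (n : nat) (a b : R) : (forall k, Ccont (f k)) ->
  CInt (fun x => psum (fun k => f k x) n) a b = psum (fun k => CInt (f k) a b) n.
Proof.
  intros H; induction n; cbn [psum]; [reflexivity|].
  rewrite CInt_plus, IHn, CInt_plus; auto using Ccont_plus, Ccont_psum.
Qed.

Lemma fejer_Ccont (M : nat) : Ccont (fejer M).
Proof. apply Ccont_csum. intros i. apply Ccont_psum, echar_Ccont. Qed.

Lemma CInt_echar (m : Z) :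
  CInt (echar m) (- / 2) (/ 2) = if Z.eqb m 0 then 1 else 0.
Proof.
  destruct (Z.eqb_spec m 0) as [->|Hm].
  - rewrite (CInt_ext _ (fun _ => 1)) by apply echar_0. rewrite CInt_const.
    replace (/ 2 - - / 2)%R with 1%R by field. ring.
  - assert (Hc : 2 * ipi * RtoC (IZR m) <> 0).
    { apply Cmult_neq_0; [apply Cmult_neq_0; [|apply Cmult_neq_0]|].
      - intros A; apply RtoC_inj in A; lra.
      - intros A; apply RtoC_inj in A; pose proof PI_RGT_0; lra.
      - apply Ci_nz.
      - intros A; apply RtoC_inj, eq_IZR in A; contradiction. }
    assert (H : 2 * ipi * RtoC (IZR m) * CInt (echar m) (- / 2) (/ 2) = 0).
    { rewrite <- CInt_scal by apply echar_Ccont.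
      rewrite (CInt_FTC (echar m)); [| apply echar_Cder | apply Ccont_scal, echar_Ccont].
      replace (/ 2)%R with (- / 2 + IZR 1)%R at 1 by field.
      rewrite echar_shift. ring. }
    transitivity (/ (2 * ipi * RtoC (IZR m)) *
      (2 * ipi * RtoC (IZR m) * CInt (echar m) (- / 2) (/ 2))).
    + rewrite Cmult_assoc, Cinv_l by exact Hc. ring.
    + rewrite H; ring.
Qed.

Lemma CInt_fejer (M : nat) : CInt (fejer M) (- / 2) (/ 2) = RtoC (INR M).
Proof.
  unfold fejer. rewrite CInt_csum by (intros; apply Ccont_psum, echar_Ccont).
  rewrite (csum_ext _ (fun _ => 1)); [rewrite csum_const; ring|].
  intros i _. unfold dirichlet. rewrite CInt_psum by apply echar_Ccont.
  induction i; cbn [psum].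
  - apply CInt_echar.
  - rewrite IHi, !CInt_echar. simpl. ring.
Qed.

Section Poisson.
Variables (f f1 f2 : R -> C) (K : R).
Hypothesis Hf : Cder f f1.
Hypothesis Hf1 : Cder f1 f2.
Hypothesis Hf2 : Ccont f2.
Hypothesis HK : forall x, (Cmod (f2 x) <= K * exp (- Rabs x))%R.

Let fc : Ccont f := Cder_cont _ _ Hf.
Let f1c : Ccont f1 := Cder_cont _ _ Hf1.

(** Two applications of the mean value inequality reduce the second difference to the second
    derivative. The factor [exp 1] pays for evaluating the latter at a point at distance at most 1
    from n. *)
Lemma second_difference_bound (n : Z) (x : R) : (0 <= x <= / 2)%R ->
  (Cmod (f (IZR n + x) + f (IZR n - x) - 2 * f (IZR n))
    <= (2 * K * exp 1 * (x * x)) * exp (- Rabs (IZR n)))%R.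
Proof.
  intros Hx. set (B := (K * exp 1 * exp (- Rabs (IZR n)))%R).
  assert (HK0 : (0 <= K)%R).
  { pose proof (HK 0) as H. rewrite Rabs_R0, Ropp_0, exp_0 in H.
    pose proof (Cmod_ge_0 (f2 0)); lra. }
  assert (HB : forall y, (- / 2 <= y <= / 2)%R -> (Cmod (f2 (y + IZR n)) <= B)%R).
  { intros y Hy. eapply Rle_trans; [apply HK|]. unfold B.
    rewrite Rmult_assoc, <- exp_plus. apply Rmult_le_compat_l; trivial. apply exp_le.
    pose proof (Rabs_triang (y + IZR n) (- y)) as H.
    replace (y + IZR n + - y)%R with (IZR n) in H by ring.
    rewrite Rabs_Ropp in H. assert (Rabs y <= 1)%R by (apply Rabs_le; lra). lra. }
  set (g := fun t => f (1 * t + IZR n)%R + f ((-1) * t + IZR n)%R).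
  set (g1 := fun t => f1 (1 * t + IZR n)%R + - (1) * f1 ((-1) * t + IZR n)%R).
  assert (Hg : Cder g g1).
  { eapply Cder_ext; [| |apply (Cder_plus _ _ _ _ (Cder_comp_lin f f1 1 (IZR n) Hf)
      (Cder_comp_lin f f1 (-1) (IZR n) Hf))]; intros t; simpl; [reflexivity|].
    unfold g1. ring. }
  assert (Hg1c : Ccont g1)
    by (apply Ccont_plus; [|apply Ccont_scal]; apply Ccont_comp_lin; exact f1c).
  assert (Hb1 : forall t, (0 <= t <= x)%R -> (Cmod (g1 t) <= 2 * B * x)%R).
  { intros t Ht. unfold g1.
    replace (f1 (1 * t + IZR n)%R + - (1) * f1 ((-1) * t + IZR n)%R)
      with (f1 (1 * t + IZR n)%R - f1 (1 * (- t) + IZR n)%R)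
      by (replace (1 * (- t))%R with ((-1) * t)%R by ring; ring).
    eapply Rle_trans.
    - apply (Cder_bound (fun t => f1 (1 * t + IZR n)%R) (fun t => RtoC 1 * f2 (1 * t + IZR n)%R)
               (- t) t B); [lra | apply Cder_comp_lin, Hf1 | apply Ccont_scal, Ccont_comp_lin, Hf2 |].
      intros y Hy. rewrite Cmult_1_l, Rmult_1_l. apply HB; lra.
    - assert (0 <= B)%R by (eapply Rle_trans; [apply Cmod_ge_0 | apply (HB 0%R); lra]).
      nra. }
  replace (f (IZR n + x) + f (IZR n - x) - 2 * f (IZR n)) with (g x - g 0%R).
  - eapply Rle_trans; [apply (Cder_bound g g1 0 x (2 * B * x)); trivial; lra|].
    unfold B. apply Req_le; ring.
  - unfold g. replace (1 * x + IZR n)%R with (IZR n + x)%R by ring.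
    replace (-1 * x + IZR n)%R with (IZR n - x)%R by ring.
    replace (1 * 0 + IZR n)%R with (IZR n) by ring.
    replace (-1 * 0 + IZR n)%R with (IZR n) by ring. ring.
Qed.

(** Truncated periodisation of f. The factor 1 keeps the argument in the shape [u * x + v] of the
    lemmas on affine substitution. *)
Let F (N : nat) (x : R) : C := psum (fun n => f (1 * x + IZR n)%R) N.

Lemma periodized_Ccont (N : nat) : Ccont (F N).
Proof. apply Ccont_psum. intros; apply Ccont_comp_lin, fc. Qed.

(** Uniform in N because the bounds for the separate n carry the summable factor exp(-|n|);
    [psum_bound] contributes the factor 3. *)
Lemma periodized_second_difference (N : nat) (x : R) : (- / 2 <= x <= / 2)%R ->
  (Cmod (F N x + F N (- x) - 2 * F N 0) <= 6 * K * exp 1 * (x * x))%R.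
Proof.
  intros Hx.
  assert (P : forall y, (0 <= y <= / 2)%R ->
     (Cmod (F N y + F N (- y) - 2 * F N 0) <= 6 * K * exp 1 * (y * y))%R).
  { intros y Hy.
    replace (F N y + F N (- y) - 2 * F N 0) with
      (psum (fun n => f (IZR n + y) + f (IZR n - y) - 2 * f (IZR n)) N).
    - eapply Rle_trans; [apply psum_bound; intros n; apply second_difference_bound, Hy|].
      apply Req_le; ring.
    - unfold F. rewrite <- psum_scal, <- psum_plus.
      transitivity (psum (fun n => f (1 * y + IZR n)%R + f (1 * - y + IZR n)%R) N
         + - (1) * psum (fun n => 2 * f (1 * 0 + IZR n)%R) N); [|ring].
      rewrite <- psum_scal, <- psum_plus. apply psum_ext. intros n.
      replace (1 * y + IZR n)%R with (IZR n + y)%R by ring.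
      replace (1 * - y + IZR n)%R with (IZR n - y)%R by ring.
      replace (1 * 0 + IZR n)%R with (IZR n) by ring. ring. }
  destruct (Rle_dec 0 x).
  - apply P; lra.
  - replace (x * x)%R with (- x * - x)%R by ring.
    rewrite (Cplus_comm (F N x)). replace (F N x) with (F N (- - x)) by (f_equal; ring).
    apply P; lra.
Qed.

(* The kernel being even, only the symmetrised difference matters, and its zero of
   order two at the origin cancels the pole of the bound for the kernel. *)
Lemma fejer_approx (M N : nat) :
  (Cmod (CInt (fun x => F N x * fejer M x)%C (- / 2) (/ 2) - RtoC (INR M) * F N 0)
    <= 3 * K * exp 1)%R.
Proof.
  set (h := fun x => (F N x - F N 0) * fejer M x).
  assert (Hc : Ccont h).
  { apply Ccont_mult; [|apply fejer_Ccont].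
    apply Ccont_minus; [apply periodized_Ccont | apply Ccont_const]. }
  assert (E : CInt (fun x => F N x * fejer M x) (- / 2) (/ 2) - RtoC (INR M) * F N 0
              = CInt h (- / 2) (/ 2)).
  { rewrite <- CInt_fejer, (Cmult_comm (CInt _ _ _)), <- CInt_scal by apply fejer_Ccont.
    rewrite <- CInt_minus.
    - apply CInt_ext; intros; unfold h; ring.
    - apply Ccont_mult; [apply periodized_Ccont | apply fejer_Ccont].
    - apply Ccont_scal, fejer_Ccont. }
  assert (Hsym : CInt (fun x => h (-1 * x + 0)%R) (- / 2) (/ 2) = CInt h (- / 2) (/ 2)).
  { pose proof (CInt_comp_lin h (-1) 0 (- / 2) (/ 2) Hc) as H.
    replace (-1 * - / 2 + 0)%R with (/ 2)%R in H by ring.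
    replace (-1 * / 2 + 0)%R with (- / 2)%R in H by ring.
    pose proof (CInt_Chasles h (- / 2) (/ 2) (- / 2) Hc) as H1.
    rewrite (CInt_FTC (fun t => CInt h 0 t) h (- / 2) (- / 2)) in H1
      by (trivial; apply CInt_upper_Cder, Hc).
    replace (CInt (fun x => h (-1 * x + 0)%R) (- / 2) (/ 2)) with
      (- (RtoC (-1) * CInt (fun x => h (-1 * x + 0)%R) (- / 2) (/ 2))) by ring.
    rewrite H.
    transitivity (CInt h (- / 2) (/ 2) - (CInt h (- / 2) (/ 2) + CInt h (/ 2) (- / 2)));
      [ring | rewrite H1; ring]. }
  assert (E2 : 2 * CInt h (- / 2) (/ 2) =
     CInt (fun x => (F N x + F N (- x) - 2 * F N 0) * fejer M x) (- / 2) (/ 2)).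
  { transitivity (CInt h (- / 2) (/ 2) + CInt (fun x => h (-1 * x + 0)%R) (- / 2) (/ 2)).
    - rewrite Hsym; ring.
    - rewrite <- CInt_plus by (trivial; apply Ccont_comp_lin, Hc).
      apply CInt_ext. intros x. unfold h.
      replace (-1 * x + 0)%R with (- x)%R by ring. rewrite fejer_even. ring. }
  assert (B : (Cmod (2 * CInt h (- / 2) (/ 2)) <= 6 * K * exp 1 * (/ 2 - - / 2))%R).
  { rewrite E2. apply CInt_bound; [lra| |].
    - apply Ccont_mult; [|apply fejer_Ccont].
      apply Ccont_minus; [|apply Ccont_const]. apply Ccont_plus; [apply periodized_Ccont|].
      apply Ccont_ext with (fun x => F N (-1 * x + 0)%R); [intros; f_equal; ring|].
      apply Ccont_comp_lin, periodized_Ccont.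
    - intros x Hx. rewrite Cmod_mult.
      pose proof (periodized_second_difference N x Hx) as A. pose proof (fejer_bound M x Hx) as A'.
      assert (HK0 : (0 <= 6 * K * exp 1)%R).
      { pose proof (HK 0) as H. rewrite Rabs_R0, Ropp_0, exp_0 in H.
        pose proof (Cmod_ge_0 (f2 0)). pose proof (exp_pos 1). nra. }
      eapply Rle_trans;
        [apply Rmult_le_compat_r; [apply Cmod_ge_0 | exact A]|].
      rewrite Rmult_assoc. rewrite <- (Rmult_1_r (6 * K * exp 1)) at 2.
      apply Rmult_le_compat_l; assumption. }
  rewrite E. rewrite Cmod_mult, Cmod_R, Rabs_pos_eq in B by lra. lra.
Qed.

Definition fourier (N : nat) (m : Z) : C :=
  CInt (fun x => f x * echar m x) (- (INR N + / 2)) (INR N + / 2).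

(** Unfolding: [echar m] has period 1, so the n-th summand is the integral over the unit interval
    centred at n, and these intervals tile the domain of [fourier]. *)
Lemma periodized_fourier (N : nat) (m : Z) :
  CInt (fun x => F N x * echar m x) (- / 2) (/ 2) = fourier N m.
Proof.
  set (g := fun x => f x * echar m x).
  assert (Hg : Ccont g) by (apply Ccont_mult; [exact fc | apply echar_Ccont]).
  assert (T : forall n, CInt (fun x => g (1 * x + IZR n)%R) (- / 2) (/ 2)
                = CInt g (IZR n - / 2) (IZR n + / 2)).
  { intros n. rewrite <- (Cmult_1_l (CInt _ (- / 2) _)), CInt_comp_lin by exact Hg.
    f_equal; ring. }
  transitivity (psum (fun n => CInt (fun x => g (1 * x + IZR n)%R) (- / 2) (/ 2)) N).
  - rewrite <- CInt_psum by (intros; apply Ccont_comp_lin, Hg).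
    apply CInt_ext. intros x. rewrite Cmult_comm. unfold F. rewrite <- psum_scal.
    apply psum_ext. intros n. unfold g. rewrite echar_shift, Rmult_1_l. ring.
  - unfold fourier. fold g. induction N; cbn [psum].
    + rewrite T. f_equal; simpl; ring.
    + rewrite IHN, !T, opp_IZR, <- INR_IZR_INZ, S_INR.
      rewrite <- (CInt_Chasles g (- (INR N + 1 + / 2)) (- (INR N + / 2))),
        <- (CInt_Chasles g (- (INR N + / 2)) (INR N + / 2) (INR N + 1 + / 2)) by exact Hg.
      replace (INR N + 1 - / 2)%R with (INR N + / 2)%R by field.
      replace (- (INR N + 1) - / 2)%R with (- (INR N + 1 + / 2))%R by field.
      replace (- (INR N + 1) + / 2)%R with (- (INR N + / 2))%R by field. ring.
Qed.

(** The sum of the first M symmetric partial sums of g is compared with M S, by the Fejer kernel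
    after N tends to infinity with M fixed, and with M L, by the decay of g. Both errors are bounded
    independently of M, so M |S - L| is bounded and S = L. *)
Theorem poisson_summation (g : Z -> C) :
  zdom (fun n => f (IZR n)) -> zdom g ->
  (forall m, Clim (fun N => fourier N m) (g m)) ->
  zsum (fun n => f (IZR n)) = zsum g.
Proof.
  intros Hzf [A HA] Hlim.
  set (S := zsum (fun n => f (IZR n))). set (L := zsum g).
  assert (B1 : forall M, (Cmod (csum (fun i => psum g i) M - RtoC (INR M) * S)
                         <= 3 * K * exp 1)%R).
  { intros M. apply Clim_le_0 with
      (fun N => csum (fun i => psum (fourier N) i) M - RtoC (INR M) * F N 0).
    - apply Clim_minus.
      + apply csum_Clim. intros i _. induction i; cbn [psum]; [apply Hlim|].
        apply Clim_plus; [assumption|]. apply Clim_plus; apply Hlim.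
      + apply Clim_scal.
        apply Clim_ext with (psum (fun n => f (IZR n))); [|apply zsum_psum, Hzf].
        intros N. apply psum_ext. intros n. f_equal; ring.
    - intros N. rewrite <- (csum_ext (fun i => CInt (fun x => F N x * dirichlet i x) (- / 2) (/ 2))).
      + rewrite <- CInt_csum.
        * rewrite (CInt_ext _ (fun x => F N x * fejer M x)); [apply fejer_approx|].
          intros x. apply csum_scal.
        * intros i. apply Ccont_mult; [apply periodized_Ccont | apply Ccont_psum, echar_Ccont].
      + intros i _. rewrite (CInt_ext _ (fun x => psum (fun m => F N x * echar m x) i)).
        * rewrite CInt_psum; [apply psum_ext; intros; apply periodized_fourier|].
          intros; apply Ccont_mult; [apply periodized_Ccont | apply echar_Ccont].
        * intros x. rewrite psum_scal. reflexivity. }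
  set (C0 := (3 * K * exp 1 + 4 * A)%R).
  assert (B2 : forall M, (INR M * Cmod (S - L) <= C0)%R).
  { intros M. pose proof (B1 M) as H1. pose proof (csum_psum_bound g A M HA) as H2.
    fold L in H2. rewrite <- (Rabs_pos_eq (INR M)) by apply pos_INR.
    rewrite <- Cmod_R, <- Cmod_mult.
    replace (RtoC (INR M) * (S - L)) with
      (csum (fun i => psum g i) M - RtoC (INR M) * L
       + - (csum (fun i => psum g i) M - RtoC (INR M) * S)) by ring.
    eapply Rle_trans; [apply Cmod_triangle|]. rewrite Cmod_opp.
    pose proof (zdom_const_nonneg g A HA). pose proof (exp_pos (- INR M)).
    unfold C0. nra. }
  apply Ceq_minus, Cmod_eq_0. pose proof (Cmod_ge_0 (S - L)) as H0.
  destruct (Req_dec (Cmod (S - L)) 0) as [E|E]; [exact E|exfalso].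
  destruct (INR_unbounded (C0 / Cmod (S - L))) as [n Hn].
  specialize (B2 n). apply Rlt_gt in Hn.
  assert (C0 < INR n * Cmod (S - L))%R; [|lra].
  apply Rmult_lt_reg_r with (/ Cmod (S - L))%R; [apply Rinv_0_lt_compat; lra|].
  rewrite Rmult_assoc, Rinv_r, Rmult_1_r by exact E. exact Hn.
Qed.

End Poisson.

(** * Theta series *)


Lemma half_C : RtoC (/ 2) = / 2.
Proof. apply RtoC_inv; lra. Qed.

Lemma im_pos_neq0 (tau : C) : (0 < Im tau)%R -> tau <> 0.
Proof. intros H E; rewrite E in H; unfold Im in H; simpl in H; lra. Qed.

Definition th_term (al be : R) (tau : C) (n : Z) : C :=
  cexp (ipi * (tau * ((RtoC (IZR n) + RtoC al) * (RtoC (IZR n) + RtoC al))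
               + 2 * RtoC be * (RtoC (IZR n) + RtoC al))).

Definition th (al be : R) (tau : C) : C := zsum (th_term al be tau).

Lemma theta_th (eps eps' : R) (tau : C) :
  theta eps eps' (RtoC 0) tau = th (eps / 2) (eps' / 2) tau.
Proof.
  unfold theta, th. apply zsum_ext. intros n. unfold th_term. f_equal.
  rewrite !RtoC_plus, RtoC_mult, half_C. field.
Qed.

Lemma th_term_gauss (al be : R) (tau : C) (n : Z) : tau <> 0 ->
  th_term al be tau n =
  cexp (- ipi * RtoC be * RtoC be / tau) * gauss tau (RtoC (IZR n) + (RtoC al + RtoC be / tau)).
Proof.
  intros Ht. unfold th_term, gauss. rewrite <- cexp_add. f_equal. field. exact Ht.
Qed.

Lemma th_zdom (al be : R) (tau : C) : (0 < Im tau)%R -> zdom (th_term al be tau).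
Proof.
  intros Ht. pose proof (im_pos_neq0 tau Ht) as H0.
  destruct (zdom_scal (cexp (- ipi * RtoC be * RtoC be / tau)) _
    (gauss_zdom tau (RtoC al + RtoC be / tau) Ht)) as [K HK].
  exists K. intros n. rewrite th_term_gauss by exact H0. apply HK.
Qed.

Lemma Cmod_sq_pos (z : C) : z <> 0 -> (0 < Re z * Re z + Im z * Im z)%R.
Proof.
  intros Hz. apply Cmod_gt_0 in Hz. pose proof (Cmod2_alt z) as E.
  assert (0 < Cmod z ^ 2)%R by (apply pow_lt; exact Hz). rewrite E in H. lra.
Qed.

Lemma im_div (x y : C) : y <> 0 ->
  Im (x / y) = ((Im x * Re y - Re x * Im y) / (Re y * Re y + Im y * Im y))%R.
Proof.
  intros Hy. pose proof (Cmod_sq_pos y Hy) as H. destruct x as [a b], y as [c d].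
  unfold Re, Im in *; simpl in *. field. nra.
Qed.

Lemma im_Sinv (tau : C) : (0 < Im tau)%R -> (0 < Im (- (1) / tau))%R.
Proof.
  intros Ht. pose proof (im_pos_neq0 tau Ht) as H0. rewrite im_div by exact H0.
  apply Rmult_lt_0_compat.
  - unfold Im, Re in *; simpl in *. lra.
  - apply Rinv_0_lt_compat, Cmod_sq_pos, H0.
Qed.

(** Completing the square in the theta term turns the characteristics into a translation of the
    Gaussian. The constant kappa is chosen before al and be: the same one serves all
    characteristics, so a product of two theta values involves exactly its square. *)
Lemma th_inversion (tau : C) : (0 < Im tau)%R ->
  exists kappa, kappa * kappa = Ci / tau /\ forall al be,
    th al be tau = kappa * cexp (2 * ipi * (RtoC al * RtoC be)) * th be (- al) (- (1) / tau).
Proof.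
  intros Ht. pose proof (im_pos_neq0 tau Ht) as H0.
  destruct (gaussT_lim tau Ht) as [kappa [Hk Hk2]].
  exists kappa. split; [exact Hk2|]. intros al be.
  set (w := RtoC al + RtoC be / tau).
  set (c := cexp (- ipi * RtoC be * RtoC be / tau)).
  set (c' := cexp (ipi * RtoC be * RtoC be / tau) * cexp (2 * ipi * (RtoC al * RtoC be))).
  assert (Hcc : c * c' = cexp (2 * ipi * (RtoC al * RtoC be))).
  { unfold c, c'. rewrite Cmult_assoc, <- !cexp_add. f_equal. field. exact H0. }
  set (s := - (1) / tau).
  assert (Hs : (0 < Im s)%R) by (apply im_Sinv, Ht).
  (* The right side is the m-th Fourier coefficient of the translated Gaussian: multiplication by
     exp(2 pi i m x) moves the translation from w to w + m/tau and leaves this constant phase. *)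
  assert (Hg : forall m, kappa * c' * th_term be (- al) s m =
     cexp (- ipi * (2 * RtoC (IZR m) * w + RtoC (IZR m) * RtoC (IZR m) / tau)) * kappa).
  { intros m. unfold c', th_term, s, w.
    rewrite (Cmult_comm kappa), <- !cexp_add, <- Cmult_assoc, (Cmult_comm kappa), Cmult_assoc,
      <- cexp_add.
    f_equal. f_equal. rewrite RtoC_opp. field. exact H0. }
  destruct (gauss_Cder2_decay tau w Ht) as [K HK].
  assert (P : zsum (fun n => gauss tau (RtoC (IZR n) + w))
            = zsum (fun m => kappa * c' * th_term be (- al) s m)).
  { refine (poisson_summation (fun x => gauss tau (RtoC x + w)) _ _ K (gauss_Cder tau w)
      (gauss_Cder2 tau w) (gauss_Cder2_cont tau w) HK _ _ _ _).
    - apply gauss_zdom, Ht.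
    - apply zdom_scal, th_zdom, Hs.
    - intros m. rewrite Hg.
      pose proof (Clim_plus _ _ _ _ (gaussT_shift tau Ht (w + RtoC (IZR m) / tau)) Hk) as L.
      rewrite Cplus_0_l in L.
      apply (Clim_scal (cexp (- ipi * (2 * RtoC (IZR m) * w
               + RtoC (IZR m) * RtoC (IZR m) / tau)))) in L.
      apply Clim_ext with (2 := L). intros N.
      match goal with |- _ * (?x - ?y + ?y) = _ => replace (x - y + y) with x by ring end.
      rewrite <- CInt_scal by apply gauss_Ccont. apply CInt_ext. intros x.
      unfold gauss, echar. rewrite <- !cexp_add. f_equal. field. exact H0. }
  rewrite zsum_scal in P by apply th_zdom, Hs.
  unfold th at 1. rewrite (zsum_ext _ (fun n => c * gauss tau (RtoC (IZR n) + w)))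
    by (intros; apply th_term_gauss, H0).
  rewrite zsum_scal, P by apply gauss_zdom, Ht.
  rewrite <- Hcc. unfold th. ring.
Qed.

Lemma Z_consecutive_even (n : Z) : exists k, (n * n + n = 2 * k)%Z.
Proof.
  destruct (Z.Even_or_Odd n) as [[k Hk]|[k Hk]]; subst n.
  - exists (2 * k * k + k)%Z; ring.
  - exists ((2 * k + 1) * (k + 1))%Z; ring.
Qed.

(** The n-th term gains exp(pi i (n + 1/2 + u)^2). Since n^2 + n is even, the dependence on n is
    only exp(2 pi i n u), which adding u to v absorbs; the centring of the characteristics at 1/2
    provides the linear n. *)
Lemma th_translation (u v : R) (tau : C) : (0 < Im tau)%R ->
  th (/ 2 + u) (/ 2 + v) (tau + 1) =
  cexp (ipi * (/ 4 - RtoC u * RtoC u)) * th (/ 2 + u) (/ 2 + (u + v)) tau.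
Proof.
  intros Ht. unfold th. rewrite <- zsum_scal by apply th_zdom, Ht.
  apply zsum_ext. intros n. unfold th_term. rewrite <- cexp_add.
  destruct (Z_consecutive_even n) as [k Hk].
  apply (cexp_eq_mod k).
  apply (f_equal IZR) in Hk. rewrite plus_IZR, !mult_IZR in Hk.
  apply (f_equal RtoC) in Hk. rewrite RtoC_plus, !RtoC_mult in Hk.
  rewrite !RtoC_plus, half_C.
  replace (2 * ipi * RtoC (IZR k)) with (ipi * (2 * RtoC (IZR k))) by ring.
  rewrite <- Hk. field.
Qed.

Lemma th_shift (u v : R) (m n : Z) (tau : C) : (0 < Im tau)%R ->
  th (/ 2 + (u + IZR m)) (/ 2 + (v + IZR n)) tau =
  cexp (ipi * (RtoC (IZR n) * (1 + 2 * RtoC u))) * th (/ 2 + u) (/ 2 + v) tau.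
Proof.
  intros Ht. unfold th. rewrite <- (zsum_shift (th_term (/ 2 + u) (/ 2 + v) tau) m)
    by apply th_zdom, Ht.
  rewrite <- zsum_scal.
  - apply zsum_ext. intros k. unfold th_term. rewrite <- cexp_add.
    apply (cexp_eq_mod (n * (k + m))).
    rewrite mult_IZR, plus_IZR, !RtoC_plus, RtoC_mult, RtoC_plus, half_C.
    field.
  - destruct (zdom_affine _ 1 m ltac:(lia) (th_zdom (/ 2 + u) (/ 2 + v) tau Ht)) as [K HK].
    exists K. intros k. specialize (HK k). rewrite Z.mul_1_l in HK. exact HK.
Qed.

(** The substitution n -> -(n + 1) changes n + 1/2 - u into -(n + 1/2 + u). The quadratic part is
    preserved; the phase is the mismatch between 1/2 - v and -(1/2 + v) in the linear part. *)
Lemma th_opp (u v : R) (tau : C) : (0 < Im tau)%R ->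
  th (/ 2 - u) (/ 2 - v) tau =
  cexp (- (2) * ipi * (/ 2 + RtoC u)) * th (/ 2 + u) (/ 2 + v) tau.
Proof.
  intros Ht. pose proof (th_zdom (/ 2 - u) (/ 2 - v) tau Ht) as Hz.
  unfold th. rewrite <- zsum_scal by apply th_zdom, Ht.
  rewrite <- (zsum_opp (th_term (/ 2 - u) (/ 2 - v) tau)), <- zsum_shift1.
  - apply zsum_ext. intros n. unfold th_term. rewrite <- cexp_add.
    apply (cexp_eq_mod (- n)).
    rewrite !opp_IZR, plus_IZR, !RtoC_opp, !RtoC_minus, !RtoC_plus, half_C.
    field.
  - destruct (zdom_affine _ (-1) 0 ltac:(lia) Hz) as [K HK].
    exists K. intros k. specialize (HK k).
    replace (-1 * k + 0)%Z with (- k)%Z in HK by ring. exact HK.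
  - exact Hz.
Qed.

(** * Euler's pentagonal number theorem *)

Fixpoint tri (s : nat) : nat := match s with O => O | S s' => (tri s' + s)%nat end.

Section Shanks.
Variable q : C.

(** For s <= n this is the quotient of q-Pochhammer products (q)_n / (q)_s, written without
    division. *)
Definition qprod_above (n s : nat) : C :=
  cprod1 n (fun i => if Nat.leb i s then 1 else 1 - q ^ i).

Lemma cprod1_S (n : nat) (f : nat -> C) : cprod1 (S n) f = cprod1 n f * f (S n).
Proof. reflexivity. Qed.

Lemma cprod1_ext (n : nat) (f g : nat -> C) :
  (forall i, (1 <= i <= n)%nat -> f i = g i) -> cprod1 n f = cprod1 n g.
Proof.
  induction n; intros H; simpl; [reflexivity|].
  rewrite IHn, (H (S n)); auto; try lia. intros; apply H; lia.
Qed.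

Lemma qprod_above_diag (n s : nat) : (n <= s)%nat -> qprod_above n s = 1.
Proof.
  unfold qprod_above. induction n; intros H; [reflexivity|].
  rewrite cprod1_S, IHn by lia. destruct (Nat.leb_spec (S n) s); [ring | lia].
Qed.

Lemma qprod_above_S (n s : nat) : (s <= n)%nat ->
  qprod_above (S n) s = qprod_above n s * (1 - q ^ (S n)).
Proof.
  intros H. unfold qprod_above. rewrite cprod1_S.
  destruct (Nat.leb_spec (S n) s); [lia | reflexivity].
Qed.

Lemma qprod_above_pred (n s : nat) : (s < n)%nat ->
  qprod_above n s = (1 - q ^ (S s)) * qprod_above n (S s).
Proof.
  induction n; intros H; [lia|].
  destruct (Nat.eq_dec s n) as [->|Hs].
  - rewrite qprod_above_S, !qprod_above_diag by lia. ring.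
  - rewrite !qprod_above_S, IHn by lia. ring.
Qed.

Definition shanks (n : nat) : C :=
  csum (fun s => (- (1)) ^ s * (qprod_above n s * q ^ (s * n + tri s))) (S n).

(** The exponents are the generalised pentagonal numbers n(3n-1)/2 and n(3n+1)/2. *)
Fixpoint pent (n : nat) : C :=
  match n with
  | O => 1
  | S m => pent m + (- (1)) ^ n * (q ^ (n * n + tri m) + q ^ (n * n + tri n))
  end.

(** Telescoping in s: by [qprod_above_pred], the part with 1 - q^s at index s cancels the other part
    at index s - 1. The summand is what the term of index s in [shanks] loses when n becomes n +
    1. *)
Lemma shanks_step (n k : nat) : (k <= n)%nat ->
  csum (fun s => (- (1)) ^ s * (qprod_above n s * q ^ (s * n + tri s) * (1 - q ^ s)
     + qprod_above n s * q ^ (s * n + tri s) * q ^ (n + 1 + s))) (S k)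
  = (- (1)) ^ k * (qprod_above n k * q ^ (k * n + tri k) * q ^ (n + 1 + k)).
Proof.
  induction k; intros H.
  - simpl. ring.
  - remember (S k) as k1. cbn [csum]. subst k1. rewrite IHk by lia.
    rewrite (qprod_above_pred n k) by lia.
    replace (S k * n + tri (S k))%nat with (k * n + tri k + (n + 1 + k))%nat by (simpl; lia).
    rewrite (Cpow_add_r q (k * n + tri k) (n + 1 + k)), (Cpow_S (- (1))). ring.
Qed.

(** Passing to n + 1, the telescoped loss has exponent (n+1)^2 + [tri n], and the new index s = n +
    1 brings (n+1)^2 + [tri (S n)]: the two new pentagonal terms. *)
Lemma shanks_identity (n : nat) : shanks n = pent n.
Proof.
  induction n.
  - unfold shanks. simpl. rewrite qprod_above_diag by lia. ring.
  - cbn [pent]. rewrite <- IHn. unfold shanks. remember (S n) as n1. cbn [csum].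
    rewrite qprod_above_diag by lia.
    rewrite (csum_ext _ (fun s => (- (1)) ^ s * (qprod_above n s * q ^ (s * n + tri s))
      + - (1) * ((- (1)) ^ s * (qprod_above n s * q ^ (s * n + tri s) * (1 - q ^ s)
      + qprod_above n s * q ^ (s * n + tri s) * q ^ (n + 1 + s))))).
    + rewrite csum_plus, csum_scal. subst n1. rewrite shanks_step by lia.
      rewrite (qprod_above_diag n n) by lia.
      replace (S n * S n + tri n)%nat with (n * n + tri n + (n + 1 + n))%nat by lia.
      rewrite (Cpow_add_r q (n * n + tri n)), (Cpow_S (- (1))). ring.
    + intros s Hs. subst n1. rewrite qprod_above_S by lia.
      replace (s * S n + tri s)%nat with (s * n + tri s + s)%nat by lia.
      replace (n + 1 + s)%nat with (S n + s)%nat by lia.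
      rewrite (Cpow_add_r q (s * n + tri s)), (Cpow_add_r q (S n)). ring.
Qed.

Variable c : R.
Hypothesis Hc : (0 < c)%R.
Hypothesis Hq : Cmod q = exp (- c).

Lemma Cmod_q_pow (n : nat) : Cmod (q ^ n) = exp (- (c * INR n)).
Proof.
  rewrite Cmod_pow, Hq. induction n; simpl pow.
  - simpl. rewrite Rmult_0_r, Ropp_0, exp_0. reflexivity.
  - rewrite IHn, S_INR, <- exp_plus. f_equal; ring.
Qed.

Lemma qprod_above_bound (n s : nat) :
  (Cmod (qprod_above n s) <= exp (/ (1 - exp (- c))))%R.
Proof.
  assert (Hr : (0 < exp (- c) < 1)%R).
  { split; [apply exp_pos|]. rewrite <- exp_0. apply exp_increasing; lra. }
  set (r := exp (- c)) in *.
  (* The exponent is the sum of r^i over i < n, so each new factor may be as large as exp(r^n) >= 1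
     + r^n. *)
  assert (A : (Cmod (qprod_above n s) <= exp (/ (1 - r) * (1 - r ^ n)))%R).
  { induction n.
    - unfold qprod_above; simpl. rewrite Cmod_1, Rminus_diag, Rmult_0_r, exp_0; lra.
    - unfold qprod_above in *. rewrite cprod1_S, Cmod_mult.
      replace (/ (1 - r) * (1 - r ^ S n))%R with (/ (1 - r) * (1 - r ^ n) + r ^ n)%R
        by (simpl; field; lra).
      rewrite exp_plus. apply Rmult_le_compat; try apply Cmod_ge_0; trivial.
      assert (Hp : (0 < r ^ n)%R) by (apply pow_lt; lra).
      eapply Rle_trans; [|apply exp_ineq1_le].
      destruct (Nat.leb (S n) s).
      + rewrite Cmod_1. lra.
      + eapply Rle_trans; [apply Cmod_triangle|].
        rewrite Cmod_opp, Cmod_1, Cmod_pow, Hq. fold r. simpl. nra. }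
  eapply Rle_trans; [exact A|]. apply exp_le.
  rewrite <- (Rmult_1_r (/ (1 - r))) at 2. apply Rmult_le_compat_l.
  - apply Rlt_le, Rinv_0_lt_compat; lra.
  - pose proof (pow_lt r n ltac:(lra)). lra.
Qed.

(** The term s = 0 of [shanks] is the Euler product up to n. Each of the n other terms carries a
    power of q of exponent at least n, and n exp(-c n) tends to 0. *)
Lemma euler_prod_lim (l : C) :
  Clim pent l -> Clim (fun n => cprod1 n (fun i => 1 - q ^ i)) l.
Proof.
  intros Hl. set (B := exp (/ (1 - exp (- c)))).
  assert (HB : (0 < B)%R) by apply exp_pos.
  assert (D : Clim (fun n => shanks n - cprod1 n (fun i => 1 - q ^ i)) 0).
  { apply Clim_squeeze with (fun n => (B * (2 / c)) * exp (- ((c / 2) * INR n)))%R;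
      [|apply ex_series_lim_0, ex_series_exp; lra].
    intros n. unfold shanks. rewrite csum_S_l.
    replace (cprod1 n (fun i => 1 - q ^ i)) with (qprod_above n 0).
    2: { apply cprod1_ext. intros i Hi. destruct (Nat.leb_spec i 0); [lia | reflexivity]. }
    replace (_ - 0) with (csum (fun k => (- (1)) ^ S k *
      (qprod_above n (S k) * q ^ (S k * n + tri (S k)))) n) by (simpl; ring).
    pose proof (pos_INR n) as Hn.
    eapply Rle_trans; [apply csum_bound_const with (K := (B * exp (- (c * INR n)))%R)|].
    - intros k _. rewrite !Cmod_mult, Cmod_pow, Cmod_m1, pow1, Rmult_1_l.
      apply Rmult_le_compat; try apply Cmod_ge_0; [apply qprod_above_bound|].
      rewrite Cmod_q_pow. apply exp_le, Ropp_le_contravar, Rmult_le_compat_l; [lra|].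
      apply le_INR. simpl. lia.
    (* Half of the rate c is spent on the factor n: with x = exp(-c n / 2), n x <= 2/c. *)
    - pose proof (exp_ineq1_le (c / 2 * INR n)) as E.
      replace (exp (- (c * INR n))) with
        (exp (- (c / 2 * INR n)) * exp (- (c / 2 * INR n)))%R
        by (rewrite <- exp_plus; f_equal; field).
      assert (E1 : (exp (c / 2 * INR n) * exp (- (c / 2 * INR n)) = 1)%R)
        by (rewrite <- exp_plus, Rplus_opp_r; apply exp_0).
      set (x := exp (- (c / 2 * INR n))) in *.
      assert (Hx : (0 < x)%R) by apply exp_pos.
      assert (F : (INR n * x <= 2 / c)%R).
      { apply Rmult_le_reg_l with (c / 2)%R; [lra|].
        replace (c / 2 * (2 / c))%R with 1%R by (field; lra). nra. }
      replace (INR n * (B * (x * x)))%R with (B * x * (INR n * x))%R by ring.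
      replace (B * (2 / c) * x)%R with (B * x * (2 / c))%R by ring.
      apply Rmult_le_compat_l; [nra | exact F]. }
  apply Clim_ext with (fun n => pent n - (shanks n - cprod1 n (fun i => 1 - q ^ i))).
  - intros n. rewrite shanks_identity. ring.
  - replace l with (l - 0) by ring. apply Clim_minus; assumption.
Qed.

End Shanks.

Lemma INR_tri (n : nat) : (2 * INR (tri n) = INR n * (INR n + 1))%R.
Proof.
  induction n; [simpl; ring|]. cbn [tri]. rewrite plus_INR, !S_INR. lra.
Qed.

(** This is (-1)^n q^(n(3n+1)/2) as one exponential; negative n supplies the exponents n(3n-1)/2. *)
Definition pent_term (tau : C) (n : Z) : C :=
  cexp (ipi * (tau * (3 * (RtoC (IZR n) * RtoC (IZR n)) + RtoC (IZR n)) + RtoC (IZR n))).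

Lemma m1_pow_cexp (n : nat) : (- (1)) ^ n = cexp (ipi * RtoC (INR n)).
Proof. rewrite <- cexp_ipi, cexp_pow. f_equal; ring. Qed.

Lemma qq_pow (tau : C) (n : nat) : (qq tau) ^ n = cexp (2 * ipi * tau * RtoC (INR n)).
Proof. unfold qq. rewrite cexp_pow. f_equal. rewrite RtoC_mult. ring. Qed.

Lemma pent_psum (tau : C) (n : nat) : pent (qq tau) n = psum (pent_term tau) n.
Proof.
  induction n.
  - simpl. unfold pent_term. rewrite <- cexp_0. f_equal; ring.
  - cbn [pent psum]. rewrite IHn. f_equal.
    rewrite Cplus_comm. rewrite (Cplus_comm (pent_term _ _)).
    rewrite m1_pow_cexp, !qq_pow, Cmult_plus_distr_l, <- !cexp_add. unfold pent_term.
    rewrite opp_IZR, <- INR_IZR_INZ, RtoC_opp.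
    pose proof (INR_tri n) as H1. pose proof (INR_tri (S n)) as H2.
    rewrite !plus_INR, !mult_INR, S_INR in *.
    apply (f_equal RtoC) in H1, H2.
    rewrite Cplus_comm.
    f_equal.
    + apply (cexp_eq_mod (Z.of_nat (S n))).
      rewrite <- INR_IZR_INZ, S_INR.
      rewrite !RtoC_plus, !RtoC_mult, !RtoC_plus in *.
      transitivity (ipi * (RtoC (INR n) + 1 + tau * (2 * ((RtoC (INR n) + 1) * (RtoC (INR n) + 1))
         + 2 * RtoC (INR (tri n))))); [ring | rewrite H1; ring].
    + f_equal.
      rewrite !RtoC_plus, !RtoC_mult, !RtoC_plus in *.
      transitivity (ipi * (RtoC (INR n) + 1 + tau * (2 * ((RtoC (INR n) + 1) * (RtoC (INR n) + 1))
         + 2 * RtoC (INR (tri (S n)))))); [ring | rewrite H2; ring].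
Qed.

Lemma sixth_C : RtoC (/ 6) = / 6. Proof. apply RtoC_inv; lra. Qed.

(** 3n^2 + n = 3 (n + 1/6)^2 - 1/12, and the sign (-1)^n is the second characteristic 1/2. The
    factor q^(-1/24) produced here cancels the prefactor of [eta]. *)
Lemma pent_term_th (tau : C) (n : Z) :
  pent_term tau n = cexp (- ipi * (tau / 12 + / 6)) * th_term (/ 6) (/ 2) (3 * tau) n.
Proof.
  unfold pent_term, th_term. rewrite <- cexp_add. f_equal.
  rewrite sixth_C, half_C. field.
Qed.

Lemma im_3 (tau : C) : (0 < Im tau)%R -> (0 < Im (3 * tau))%R.
Proof. intros H. rewrite im_scal_l. lra. Qed.

Lemma eta_th (tau : C) : (0 < Im tau)%R ->
  eta tau = cexp (- ipi / 6) * th (/ 6) (/ 2) (3 * tau).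
Proof.
  intros Ht.
  assert (Hz : zdom (pent_term tau)).
  { destruct (zdom_scal (cexp (- ipi * (tau / 12 + / 6))) _
      (th_zdom (/ 6) (/ 2) (3 * tau) (im_3 tau Ht))) as [K HK].
    exists K. intros n. rewrite pent_term_th. apply HK. }
  assert (L : Clim (fun n => cprod1 n (fun i => 1 - (qq tau) ^ i)) (zsum (pent_term tau))).
  { apply euler_prod_lim with (2 * PI * Im tau)%R.
    - pose proof PI_RGT_0. nra.
    - unfold qq. rewrite Cmod_cexp. f_equal. unfold Re, Im; simpl; ring.
    - apply Clim_ext with (psum (pent_term tau)); [intros; symmetry; apply pent_psum|].
      apply zsum_psum, Hz. }
  unfold eta. rewrite (CLim_Clim _ _ L).
  rewrite (zsum_ext _ _ (pent_term_th tau)), zsum_scal by apply th_zdom, im_3, Ht.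
  unfold th. rewrite Cmult_assoc, <- cexp_add. f_equal. f_equal.
  rewrite RtoC_mult. field.
Qed.

(** * Klein forms *)


Lemma eta_translation (tau : C) : eta (tau + 1) = cexp (ipi / 12) * eta tau.
Proof.
  assert (E : qq (tau + 1) = qq tau).
  { apply (cexp_eq_mod 1). rewrite RtoC_mult. ring. }
  unfold eta. rewrite E, Cmult_assoc, <- cexp_add. f_equal. f_equal.
  rewrite RtoC_mult. field.
Qed.

Lemma cexp_ipi_third : cexp (ipi / 3) + cexp (- (ipi / 3)) = 1.
Proof.
  assert (E : cos (PI / 3) = (1 / 2)%R) by apply cos_PI3.
  assert (A : ipi / 3 = (0, PI / 3)%R).
  { apply C_ext; simpl; field. }
  rewrite A.
  apply C_ext; unfold cexp, Re, Im; simpl;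
    rewrite ?Ropp_0, exp_0, ?cos_neg, ?sin_neg, ?E; field.
Qed.

(* Splitting the dual series modulo 3: the class of 1 is antisymmetric, the other
   two classes both give back the original series. *)
Lemma th_mod3 (sigma : C) : (0 < Im sigma)%R ->
  th (/ 2) (- / 6) (sigma / 3) = (1 + cexp (- (ipi / 3))) * th (/ 6) (/ 2) (3 * sigma).
Proof.
  intros Hs.
  assert (Hs3 : (0 < Im (sigma / 3))%R).
  { replace (sigma / 3) with (RtoC (/ 3) * sigma) by (rewrite RtoC_inv by lra; field).
    rewrite im_scal_l. lra. }
  pose proof (th_zdom (/ 2) (- / 6) (sigma / 3) Hs3) as Hz.
  pose proof (th_zdom (/ 6) (/ 2) (3 * sigma) (im_3 sigma Hs)) as Hz'.
  unfold th. rewrite zsum_mod3 by exact Hz.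
  assert (E0 : zsum (fun n => th_term (/ 2) (- / 6) (sigma / 3) (3 * n)%Z)
             = cexp (- (ipi / 3)) * zsum (th_term (/ 6) (/ 2) (3 * sigma))).
  { rewrite <- zsum_scal by exact Hz'. apply zsum_ext. intros n.
    unfold th_term. rewrite <- cexp_add. apply (cexp_eq_mod (- n)).
    rewrite mult_IZR, opp_IZR, !RtoC_opp, RtoC_mult, half_C, sixth_C. field. }
  assert (E2 : zsum (fun n => th_term (/ 2) (- / 6) (sigma / 3) (3 * n + -1)%Z)
             = zsum (th_term (/ 6) (/ 2) (3 * sigma))).
  { rewrite <- (zsum_opp (th_term (/ 6) (/ 2) (3 * sigma))) by exact Hz'.
    apply zsum_ext. intros n. unfold th_term. f_equal.
    rewrite plus_IZR, mult_IZR, opp_IZR, RtoC_plus, !RtoC_opp, RtoC_mult, half_C, sixth_C.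
    field. }
  set (g := fun n => th_term (/ 2) (- / 6) (sigma / 3) (3 * n + 1)%Z) in *.
  assert (Hg : zdom g) by (apply zdom_affine; [lia | exact Hz]).
  assert (E1 : zsum g = - (1) * zsum g).
  { rewrite <- zsum_scal by exact Hg.
    rewrite <- (zsum_opp g) by exact Hg.
    rewrite <- zsum_shift1.
    - apply zsum_ext. intros n. unfold g, th_term. rewrite <- cexp_ipi, <- cexp_add.
      apply (cexp_eq_mod n).
      rewrite !plus_IZR, !mult_IZR, opp_IZR, !plus_IZR, !RtoC_plus, !RtoC_mult, !RtoC_opp,
        !RtoC_plus, half_C, sixth_C.
      field.
    - destruct (zdom_affine g (-1) 0 ltac:(lia) Hg) as [K HK].
      exists K. intros k. specialize (HK k).
      replace (-1 * k + 0)%Z with (- k)%Z in HK by ring. exact HK. }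
  assert (E1' : zsum g = 0).
  { transitivity (/ 2 * (zsum g - - (1) * zsum g)); [field | rewrite <- E1; ring]. }
  rewrite E0, E1', E2. ring.
Qed.

Lemma eta_inversion (tau : C) : (0 < Im tau)%R ->
  eta tau * eta tau = Ci / tau * (eta (- (1) / tau) * eta (- (1) / tau)).
Proof.
  intros Ht. pose proof (im_pos_neq0 tau Ht) as H0.
  pose proof (im_Sinv tau Ht) as Hs.
  destruct (th_inversion (3 * tau) (im_3 tau Ht)) as [kappa [Hk H]].
  rewrite (eta_th tau Ht), (eta_th _ Hs), (H (/ 6)%R (/ 2)%R).
  replace (- (1) / (3 * tau)) with (- (1) / tau / 3) by (field; exact H0).
  rewrite (th_mod3 _ Hs).
  set (T := th (/ 6) (/ 2) (3 * (- (1) / tau))).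
  replace (cexp (2 * ipi * (RtoC (/ 6) * RtoC (/ 2)))) with (cexp (ipi / 6))
    by (f_equal; rewrite half_C, sixth_C; field).
  set (e := cexp (- ipi / 6)).
  transitivity (kappa * kappa * ((cexp (ipi / 6) * cexp (ipi / 6))
    * ((1 + cexp (- (ipi / 3))) * (1 + cexp (- (ipi / 3))))) * (e * T * (e * T))); [ring|].
  (* This is (2 cos(pi/6))^2; the 3 cancels the one in kappa^2 = i / (3 tau). *)
  assert (E : (cexp (ipi / 6) * cexp (ipi / 6))
    * ((1 + cexp (- (ipi / 3))) * (1 + cexp (- (ipi / 3)))) = 3).
  { rewrite <- cexp_add. replace (ipi / 6 + ipi / 6) with (ipi / 3) by field.
    assert (A : cexp (ipi / 3) * cexp (- (ipi / 3)) = 1).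
    { rewrite <- cexp_add, <- cexp_0. f_equal; ring. }
    transitivity (cexp (ipi / 3) + 2 * (cexp (ipi / 3) * cexp (- (ipi / 3)))
      + cexp (ipi / 3) * cexp (- (ipi / 3)) * cexp (- (ipi / 3))); [ring|].
    rewrite A. transitivity (cexp (ipi / 3) + cexp (- (ipi / 3)) + 2); [ring|].
    rewrite cexp_ipi_third. ring. }
  rewrite E, Hk. field. exact H0.
Qed.

(* The reciprocal of the product of two Klein forms, of characteristics (u, v) and (u', v'). *)
Definition klein_inv (u v u' v' : R) (tau : C) : C :=
  cexp (ipi * (RtoC u * RtoC v + RtoC u + RtoC u' * RtoC v' + RtoC u')) *
  (eta tau ^ 6 * (/ th (/ 2 + u) (/ 2 + v) tau * / th (/ 2 + u') (/ 2 + v') tau)).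

(** The sixth power of [eta] gives exp(pi i / 2), which cancels the two constants exp(pi i / 4) of
    the theta values. The remaining u^2 + u'^2 is what u v + u' v' gains when u is added to v and u'
    to v'. *)
Lemma klein_inv_translation (u v u' v' : R) (tau : C) : (0 < Im tau)%R ->
  klein_inv u v u' v' (tau + 1) = klein_inv u (u + v) u' (u' + v') tau.
Proof.
  intros Ht. unfold klein_inv.
  rewrite eta_translation, !th_translation by exact Ht.
  rewrite !Cinv_mult_distr, Cpow_mult_l, cexp_pow, <- !cexp_opp.
  match goal with |- ?x1 * (?x2 * ?e * (?x3 * ?t * (?x4 * ?t'))) = ?y * _ =>
    transitivity (x1 * x2 * x3 * x4 * (e * (t * t'))); [ring|];
    assert (X : x1 * x2 * x3 * x4 = y) end.
  - rewrite <- !cexp_add. f_equal.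
    rewrite !RtoC_plus. simpl INR. rewrite !RtoC_plus. field.
  - rewrite X. ring.
Qed.

(** The sixth power of [eta] contributes (i/tau)^3 and the two theta values divide by kappa^2 =
    i/tau. The quotient is -1/tau^2, whose sign is compensated by the collected phases. *)
Lemma klein_inv_inversion (u v u' v' : R) (tau : C) : (0 < Im tau)%R ->
  klein_inv u v u' v' (- (1) / tau) = tau ^ 2 * klein_inv (- v) u (- v') u' tau.
Proof.
  intros Ht. pose proof (im_pos_neq0 tau Ht) as H0. pose proof (im_Sinv tau Ht) as Hs.
  destruct (th_inversion tau Ht) as [kappa [Hk H]].
  assert (Hk0 : kappa <> 0).
  { intros E. rewrite E in Hk. apply Ci_nz.
    transitivity (Ci / tau * tau); [field; exact H0 | rewrite <- Hk; ring]. }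
  assert (T : forall x y, th (/ 2 + - y) (/ 2 + x) tau =
    kappa * cexp (- (2) * ipi * ((/ 2 + RtoC x) * (/ 2 + RtoC y)))
    * th (/ 2 + x) (/ 2 + y) (- (1) / tau)).
  { intros x y. rewrite (H (/ 2 + - y)%R (/ 2 + x)%R).
    (* Inversion yields the second characteristic -(1/2 - y) = 1/2 + (y - 1); a shift by -1 brings
       it back to the centred form. The null shift in the first characteristic gives [th_shift] its
       shape. *)
    replace (/ 2 + x)%R with (/ 2 + (x + IZR 0))%R at 2 by (simpl; ring).
    replace (- (/ 2 + - y))%R with (/ 2 + (y + IZR (-1)))%R by (simpl; field).
    rewrite th_shift by exact Hs. rewrite <- Cmult_assoc, (Cmult_assoc (cexp _)), <- cexp_add.
    rewrite Cmult_assoc. f_equal. f_equal. f_equal.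
    rewrite !RtoC_plus, RtoC_opp, half_C. field. }
  unfold klein_inv. rewrite (T u v), (T u' v').
  assert (E6 : eta tau ^ 6 = (Ci / tau) * (Ci / tau) * (Ci / tau) * eta (- (1) / tau) ^ 6).
  { transitivity ((eta tau * eta tau) * (eta tau * eta tau) * (eta tau * eta tau)); [ring|].
    rewrite (eta_inversion tau Ht). ring. }
  rewrite E6. rewrite !Cinv_mult_distr, <- !cexp_opp.
  set (e := eta (- (1) / tau) ^ 6). set (t1 := / th (/ 2 + u) _ _).
  set (t2 := / th (/ 2 + u') _ _). set (L := cexp _ * _).
  match goal with |- L = _ * (?x1 * (_ * (/ kappa * ?x2 * t1 * (/ kappa * ?x3 * t2)))) =>
    transitivity (tau ^ 2 * (Ci / tau * (Ci / tau) * (Ci / tau)) * / (kappa * kappa) *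
      (x1 * x2 * x3) * (e * (t1 * t2)));
    [|field; split; [exact Hk0 | exact H0]];
    replace (x1 * x2 * x3) with (- (1) * cexp (ipi *
      (RtoC u * RtoC v + RtoC u + RtoC u' * RtoC v' + RtoC u'))) end.
  - rewrite Hk. unfold L.
    assert (HCi : Ci * Ci = - (1)) by (apply C_ext; simpl; ring).
    transitivity (- (Ci * Ci) * cexp (ipi *
      (RtoC u * RtoC v + RtoC u + RtoC u' * RtoC v' + RtoC u')) * (e * (t1 * t2))).
    + rewrite HCi. ring.
    + field. split; [exact H0 | exact Ci_nz].
  - rewrite <- cexp_ipi, <- !cexp_add. f_equal. rewrite !RtoC_opp. field.
Qed.

Lemma klein_inv_shift (u v u' v' : R) (m n m' n' : Z) (tau : C) : (0 < Im tau)%R ->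
  klein_inv (u + IZR m) (v + IZR n) (u' + IZR m') (v' + IZR n') tau =
  cexp (- ipi * (RtoC (IZR n) - RtoC (IZR m) - RtoC (IZR m) * RtoC (IZR n)
                 + RtoC u * RtoC (IZR n) - RtoC (IZR m) * RtoC v
               + (RtoC (IZR n') - RtoC (IZR m') - RtoC (IZR m') * RtoC (IZR n')
                 + RtoC u' * RtoC (IZR n') - RtoC (IZR m') * RtoC v')))
  * klein_inv u v u' v' tau.
Proof.
  intros Ht. unfold klein_inv. rewrite !th_shift by exact Ht.
  rewrite !Cinv_mult_distr, <- !cexp_opp.
  match goal with |- ?x1 * (?e * (?x3 * ?t * (?x4 * ?t'))) = ?y * (?z * _) =>
    transitivity (x1 * x3 * x4 * (e * (t * t'))); [ring|];
    assert (X : x1 * x3 * x4 = y * z) end.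
  - rewrite <- !cexp_add. f_equal. rewrite !RtoC_plus. ring.
  - rewrite X. ring.
Qed.

(** Oddness of one Klein form; [klein_inv_swap] carries it over to the other. *)
Lemma klein_inv_opp (u v u' v' : R) (tau : C) : (0 < Im tau)%R ->
  klein_inv (- u) (- v) u' v' tau = - klein_inv u v u' v' tau.
Proof.
  intros Ht. unfold klein_inv.
  pose proof (th_opp u v tau Ht) as H. unfold Rminus in H. rewrite H.
  rewrite !Cinv_mult_distr, <- !cexp_opp.
  match goal with |- ?x1 * (?e * (?x3 * ?t * ?t')) = - (?y * _) =>
    transitivity (x1 * x3 * (e * (t * t'))); [ring|];
    assert (X : x1 * x3 = - (1) * y) end.
  - rewrite <- cexp_ipi, <- !cexp_add. f_equal. rewrite !RtoC_opp. field.
  - rewrite X. ring.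
Qed.

Lemma klein_inv_swap (u v u' v' : R) (tau : C) :
  klein_inv u v u' v' tau = klein_inv u' v' u v tau.
Proof.
  unfold klein_inv. f_equal; [f_equal|]; ring.
Qed.

(** * The action of SL(2,Z) *)

(** Quantifying over all real characteristics lets the property compose: the second matrix acts on
    the rows produced by the first. *)
Definition klein_inv_modular (a b c d : Z) : Prop :=
  forall tau, (0 < Im tau)%R -> forall u v u' v',
    klein_inv u v u' v' (mobius a b c d tau) =
    (RtoC (IZR c) * tau + RtoC (IZR d)) ^ 2 *
    klein_inv (u * IZR a + v * IZR c) (u * IZR b + v * IZR d)
              (u' * IZR a + v' * IZR c) (u' * IZR b + v' * IZR d) tau.

Lemma denom_neq0 (a b c d : Z) (tau : C) : (0 < Im tau)%R -> (a * d - b * c = 1)%Z ->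
  RtoC (IZR c) * tau + RtoC (IZR d) <> 0.
Proof.
  intros Ht Hdet E. pose proof (f_equal Im E) as E1. pose proof (f_equal Re E) as E2.
  unfold Im, Re in *; destruct tau as [x y]; simpl in *.
  assert (Hc : IZR c = 0%R) by nra.
  rewrite Hc in E2. assert (Hd : IZR d = 0%R) by lra.
  apply eq_IZR in Hc, Hd. subst. lia.
Qed.

Lemma im_mobius (a b c d : Z) (tau : C) : (0 < Im tau)%R -> (a * d - b * c = 1)%Z ->
  (0 < Im (mobius a b c d tau))%R.
Proof.
  intros Ht Hdet. pose proof (denom_neq0 a b c d tau Ht Hdet) as Hd.
  unfold mobius. rewrite im_div by exact Hd.
  apply Rmult_lt_0_compat; [|apply Rinv_0_lt_compat, Cmod_sq_pos, Hd].
  apply (f_equal IZR) in Hdet. rewrite minus_IZR, !mult_IZR in Hdet.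
  replace (_ - _)%R with (Im tau * (IZR a * IZR d - IZR b * IZR c))%R
    by (destruct tau; unfold Im, Re; simpl; ring).
  rewrite Hdet. lra.
Qed.

Lemma klein_inv_modular_mul (a b c d a' b' c' d' : Z) :
  (a' * d' - b' * c' = 1)%Z -> (a * d - b * c = 1)%Z ->
  klein_inv_modular a b c d -> klein_inv_modular a' b' c' d' ->
  klein_inv_modular (a * a' + b * c') (a * b' + b * d') (c * a' + d * c') (c * b' + d * d').
Proof.
  intros Hdet' Hdet H H' tau Ht u v u' v'.
  pose proof (denom_neq0 a' b' c' d' tau Ht Hdet') as Hd'.
  pose proof (im_mobius a' b' c' d' tau Ht Hdet') as Ht'.
  pose proof (denom_neq0 a b c d _ Ht' Hdet) as Hd.
  (* Cocycle relation of the automorphy factor. *)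
  assert (E : (RtoC (IZR c) * mobius a' b' c' d' tau + RtoC (IZR d)) *
              (RtoC (IZR c') * tau + RtoC (IZR d')) =
              RtoC (IZR (c * a' + d * c')) * tau + RtoC (IZR (c * b' + d * d'))).
  { unfold mobius. rewrite !plus_IZR, !mult_IZR, !RtoC_plus, !RtoC_mult.
    field. exact Hd'. }
  replace (mobius _ _ _ _ tau) with (mobius a b c d (mobius a' b' c' d' tau)).
  - rewrite H by exact Ht'. rewrite H' by exact Ht. rewrite <- E, Cpow_mult_l, Cmult_assoc.
    f_equal. f_equal; rewrite !plus_IZR, !mult_IZR; ring.
  - unfold mobius at 1 3. rewrite <- E.
    transitivity ((RtoC (IZR a) * mobius a' b' c' d' tau + RtoC (IZR b)) *
      (RtoC (IZR c') * tau + RtoC (IZR d')) /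
      ((RtoC (IZR c) * mobius a' b' c' d' tau + RtoC (IZR d)) *
              (RtoC (IZR c') * tau + RtoC (IZR d')))); [field; split; assumption|].
    f_equal. unfold mobius. rewrite !plus_IZR, !mult_IZR, !RtoC_plus, !RtoC_mult.
    field. exact Hd'.
Qed.

Lemma klein_inv_modular_ext (a b c d a' b' c' d' : Z) :
  a = a' -> b = b' -> c = c' -> d = d' ->
  klein_inv_modular a b c d -> klein_inv_modular a' b' c' d'.
Proof. intros; subst; assumption. Qed.

Lemma klein_inv_modular_T : klein_inv_modular 1 1 0 1.
Proof.
  intros tau Ht u v u' v'. unfold mobius.
  replace ((1 * tau + 1) / (0 * tau + 1)) with (tau + 1)
    by (field; intros E; apply C1_nz; rewrite <- E; ring).
  rewrite klein_inv_translation by exact Ht.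
  transitivity (1 * klein_inv u (u + v) u' (u' + v') tau); [ring|].
  f_equal; [ring|]. f_equal; ring.
Qed.

Lemma klein_inv_modular_Tinv : klein_inv_modular 1 (-1) 0 1.
Proof.
  intros tau Ht u v u' v'. unfold mobius.
  replace ((1 * tau + -1) / (0 * tau + 1)) with (tau - 1)
    by (field; intros E; apply C1_nz; rewrite <- E; ring).
  assert (Ht' : (0 < Im (tau - 1))%R)
    by (destruct tau; unfold Im in *; simpl in *; lra).
  pose proof (klein_inv_translation u (v - u) u' (v' - u') (tau - 1) Ht') as H.
  replace (tau - 1 + 1) with tau in H by ring.
  transitivity (1 * klein_inv u (v - u) u' (v' - u') tau).
  - rewrite H, Cmult_1_l. f_equal; ring.
  - f_equal; [ring|]. f_equal; ring.
Qed.

(** Of the two matrices ± that induce tau -> -1/tau, this one sends the row (u, v) to (-v, u), as in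
    [klein_inv_inversion]. *)
Lemma klein_inv_modular_S : klein_inv_modular 0 1 (-1) 0.
Proof.
  intros tau Ht u v u' v'. unfold mobius.
  pose proof (im_pos_neq0 tau Ht) as H0.
  replace ((0 * tau + 1) / (-1 * tau + 0)) with (- (1) / tau).
  - rewrite klein_inv_inversion by exact Ht.
    f_equal; [ring|]. f_equal; ring.
  - field. exact H0.
Qed.

Lemma klein_inv_modular_Tpow (k : Z) : klein_inv_modular 1 k 0 1.
Proof.
  assert (P : forall n : nat, klein_inv_modular 1 (Z.of_nat n) 0 1
                            /\ klein_inv_modular 1 (- Z.of_nat n) 0 1).
  { induction n as [|n [I1 I2]].
    - assert (A := klein_inv_modular_mul 1 1 0 1 1 (-1) 0 1 eq_refl eq_refl
        klein_inv_modular_T klein_inv_modular_Tinv).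
      split; exact A.
    - split.
      + eapply klein_inv_modular_ext; [| | | |
          exact (klein_inv_modular_mul 1 1 0 1 1 (Z.of_nat n) 0 1 ltac:(lia) eq_refl
            klein_inv_modular_T I1)]; lia.
      + eapply klein_inv_modular_ext; [| | | |
          exact (klein_inv_modular_mul 1 (-1) 0 1 1 (- Z.of_nat n) 0 1 ltac:(lia) eq_refl
            klein_inv_modular_Tinv I2)]; lia. }
  destruct (Z_le_dec 0 k).
  - rewrite <- (Z2Nat.id k) by assumption. exact (proj1 (P (Z.to_nat k))).
  - replace k with (- Z.of_nat (Z.to_nat (- k)))%Z by lia.
    exact (proj2 (P (Z.to_nat (- k)))).
Qed.

(** Euclidean algorithm on the first column: with a = q c + r, the matrix is the q-th power of the
    translation, times the inversion matrix, times the matrix with rows (-c, -d), (r, b - q d), and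
    |r| < |c|. *)
Theorem klein_inv_modular_SL2 (a b c d : Z) :
  (a * d - b * c = 1)%Z -> klein_inv_modular a b c d.
Proof.
  remember (Z.to_nat (Z.abs c)) as n eqn:En. revert a b c d En.
  induction n as [n IH] using lt_wf_ind. intros a b c d En Hdet.
  destruct (Z.eq_dec c 0) as [->|Hc].
  - assert (Had : (a = 1 /\ d = 1 \/ a = -1 /\ d = -1)%Z).
    { assert (E : (a * d = 1)%Z) by lia. apply Z.eq_mul_1 in E as Ea. nia. }
    destruct Had as [[Ea Ed]|[Ea Ed]]; subst a d; [apply klein_inv_modular_Tpow|].
    (* The inversion matrix squares to minus the identity, which multiplied by the translation by -b
       has rows (-1, b), (0, -1). *)
    eapply klein_inv_modular_ext; [| | | |
      exact (klein_inv_modular_mul (-1) 0 0 (-1) 1 (- b) 0 1 ltac:(lia) eq_refl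
        (klein_inv_modular_mul 0 1 (-1) 0 0 1 (-1) 0 eq_refl eq_refl
           klein_inv_modular_S klein_inv_modular_S)
        (klein_inv_modular_Tpow (- b)))]; lia.
  - pose proof (Z.div_mod a c Hc) as Ha.
    assert (Hr : (Z.abs (a mod c) < Z.abs c)%Z).
    { destruct (Z_lt_le_dec 0 c).
      - pose proof (Z.mod_pos_bound a c ltac:(lia)). lia.
      - pose proof (Z.mod_neg_bound a c ltac:(lia)). lia. }
    set (q := (a / c)%Z) in *. set (r := (a mod c)%Z) in *.
    assert (HN : klein_inv_modular (- c) (- d) r (b - q * d)).
    { apply (IH (Z.to_nat (Z.abs r))); [lia | reflexivity | nia]. }
    assert (HM : klein_inv_modular r (b - q * d) c d).
    { eapply klein_inv_modular_ext; [| | | |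
        exact (klein_inv_modular_mul 0 1 (-1) 0 (- c) (- d) r (b - q * d)
          ltac:(nia) eq_refl klein_inv_modular_S HN)]; ring. }
    eapply klein_inv_modular_ext; [| | | |
      exact (klein_inv_modular_mul 1 q 0 1 r (b - q * d) c d ltac:(nia) ltac:(lia)
        (klein_inv_modular_Tpow q) HM)]; lia.
Qed.

(** The normalising exponent is 1/25 - 1/5 - 1/25 - 1/5 = -2/5; the constant undoes it. Being
    independent of tau, it cancels in the transformation law. *)
Lemma Gfun_klein_inv (tau : C) :
  Gfun tau = cexp (2 * ipi / 5) * klein_inv (- / 5) (- / 5) (- / 5) (/ 5) tau.
Proof.
  unfold Gfun, klein_inv. rewrite !theta_th.
  replace (3 / 5 / 2)%R with (/ 2 + - / 5)%R by field.
  replace (7 / 5 / 2)%R with (/ 2 + / 5)%R by field.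
  rewrite Cmult_assoc, <- cexp_add.
  replace (2 * ipi / 5 + _) with (RtoC 0).
  - rewrite cexp_0. unfold Cdiv. rewrite Cinv_mult_distr. ring.
  - rewrite !RtoC_opp, RtoC_inv by lra. field.
Qed.

Ltac phase_field :=
  repeat (rewrite minus_IZR || rewrite plus_IZR || rewrite mult_IZR || rewrite opp_IZR);
  unfold Rdiv;
  repeat (rewrite RtoC_plus || rewrite RtoC_minus || rewrite RtoC_mult
          || rewrite RtoC_opp || rewrite RtoC_inv by lra);
  field.

Theorem mainTheorem9 (a b c d : Z) (tau : Complex.C) :
  in_Gamma_theta5 a b c d -> (0 < Im tau)%R ->
  Gfun (mobius a b c d tau) =
  nuG a b c d * (RtoC (IZR c) * tau + RtoC (IZR d)) ^ 2 * Gfun tau.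
Proof.
  intros [Hdet Hcases] Ht.
  rewrite !Gfun_klein_inv, (klein_inv_modular_SL2 a b c d Hdet tau Ht).
  set (D := (RtoC (IZR c) * tau + RtoC (IZR d)) ^ 2).
  set (Q := klein_inv (- / 5) (- / 5) (- / 5) (/ 5) tau).
  match goal with |- _ * (_ * ?X) = _ =>
    cut (X = nuG a b c d * Q); [intros ->; ring|] end.
  assert (Hmod : forall x y, (x mod 5 = y mod 5)%Z -> exists k, (x = y + 5 * k)%Z).
  { intros x y H. exists ((x / 5) - (y / 5))%Z.
    pose proof (Z.div_mod x 5 ltac:(lia)). pose proof (Z.div_mod y 5 ltac:(lia)). lia. }
  assert (Hb : forall a' b' c' d', congr5b a b c d a' b' c' d' = true <->
      congr5 a b c d a' b' c' d').
  { intros. unfold congr5b, congr5. rewrite !Bool.andb_true_iff, !Z.eqb_eq. tauto. }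
  unfold nuG, gM.
  (* The last branch of [gM] is a default; membership in the group identifies it with the fourth
     congruence once the other three tests fail. *)
  destruct (congr5b a b c d 1 0 0 1) eqn:E1;
    [|destruct (congr5b a b c d (-1) 0 0 (-1)) eqn:E2;
      [|destruct (congr5b a b c d 0 (-1) 1 0) eqn:E3;
        [|assert (E4 : congr5 a b c d 0 1 (-1) 0);
          [destruct Hcases as [H|[H|[H|H]]]; [apply Hb in H; congruence ..| exact H]|]]]].
  - apply Hb in E1. destruct E1 as (Ha & Hb' & Hc & Hd).
    apply Hmod in Ha, Hb', Hc, Hd.
    destruct Ha as [a' ->], Hb' as [b' ->], Hc as [c' ->], Hd as [d' ->].
    transitivity (klein_inv (- / 5 + IZR (- a' - c')) (- / 5 + IZR (- b' - d'))
      (- / 5 + IZR (c' - a')) (/ 5 + IZR (d' - b')) tau).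
    { f_equal; rewrite !plus_IZR, !mult_IZR, !minus_IZR, ?opp_IZR; field. }
    rewrite klein_inv_shift by exact Ht. fold Q.
    f_equal. symmetry.
    (* Divided by pi i, both exponents are polynomials in a', b', c', d' that differ by the even
       integer 2 a'. In the other cases too, the witness is half of such a difference. *)
    apply (cexp_eq_mod (a')). phase_field.
  - apply Hb in E2. destruct E2 as (Ha & Hb' & Hc & Hd).
    apply Hmod in Ha, Hb', Hc, Hd.
    destruct Ha as [a' ->], Hb' as [b' ->], Hc as [c' ->], Hd as [d' ->].
    transitivity (klein_inv (- - / 5 + IZR (- a' - c')) (- - / 5 + IZR (- b' - d'))
      (- - / 5 + IZR (c' - a')) (- / 5 + IZR (d' - b')) tau).
    { f_equal; rewrite !plus_IZR, !mult_IZR, !minus_IZR, ?opp_IZR; field. }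
    (* Both characteristics change sign, and the two signs cancel. *)
    rewrite klein_inv_shift, klein_inv_opp, klein_inv_swap, klein_inv_opp, klein_inv_swap by exact Ht. fold Q.
    match goal with |- ?x * - - Q = _ => transitivity (x * Q); [ring|] end.
    f_equal. symmetry.
    apply (cexp_eq_mod (a' + b')). phase_field.
  - apply Hb in E3. destruct E3 as (Ha & Hb' & Hc & Hd).
    apply Hmod in Ha, Hb', Hc, Hd.
    destruct Ha as [a' ->], Hb' as [b' ->], Hc as [c' ->], Hd as [d' ->].
    transitivity (klein_inv (- / 5 + IZR (- a' - c')) (/ 5 + IZR (- b' - d'))
      (- - / 5 + IZR (c' - a')) (- - / 5 + IZR (d' - b')) tau).
    { f_equal; rewrite !plus_IZR, !mult_IZR, !minus_IZR, ?opp_IZR; field. }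
    rewrite klein_inv_shift, klein_inv_swap, klein_inv_opp by exact Ht. fold Q.
    (* The characteristics are exchanged and one sign is left; as exp(pi i) it accounts for the
       summand 5 of g(M). *)
    match goal with |- ?x * - Q = _ => transitivity (- (1) * x * Q); [ring|] end.
    rewrite <- cexp_ipi, <- cexp_add. f_equal. symmetry.
    apply (cexp_eq_mod (d' + a' - b')). phase_field.
  - destruct E4 as (Ha & Hb' & Hc & Hd).
    apply Hmod in Ha, Hb', Hc, Hd.
    destruct Ha as [a' ->], Hb' as [b' ->], Hc as [c' ->], Hd as [d' ->].
    transitivity (klein_inv (- - / 5 + IZR (- a' - c')) (- / 5 + IZR (- b' - d'))
      (- / 5 + IZR (c' - a')) (- / 5 + IZR (d' - b')) tau).
    { f_equal; rewrite !plus_IZR, !mult_IZR, !minus_IZR, ?opp_IZR; field. }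
    rewrite klein_inv_shift, klein_inv_opp, klein_inv_swap by exact Ht. fold Q.
    match goal with |- ?x * - Q = _ => transitivity (- (1) * x * Q); [ring|] end.
    rewrite <- cexp_ipi, <- cexp_add. f_equal. symmetry.
    apply (cexp_eq_mod (a' - b' - d')). phase_field.
Qed.
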